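(* Let $\ell\in\mathbb{Z}$ and $m\in\{0,1,2,\ldots\}$ with $m\ge\ell$. For all $x\in\mathbb{R}$, $x\neq0$, $$\left.\frac{\partial \mathrm{M}_{\kappa,\mu}(x)}{\partial\mu}\right|_{\kappa=\ell/2,\,\mu=m+(1-\ell)/2}=(2m-\ell+1)\binom{2m-\ell}{m}x^{\ell/2-m}e^{-x/2}\Big\{(-1)^{m-\ell}\left(\ln x+2H_{2m-\ell+1}-H_{m-\ell}-H_m\right)\left[e^{x}\mathcal{P}(-\ell,m-\ell,-x)-\mathcal{P}(\ell,m,x)\right]+x^{2m+1-\ell}\left[e^{x}\mathcal{F}(-\ell,m-\ell,-x)+\mathcal{F}(\ell,m,x)\right]\Big\}.$$
   Context: The Whittaker function is $\mathrm{M}_{\kappa,\mu}(x)=x^{\mu+1/2}e^{-x/2}\,{}_1F_1\!\left(\tfrac12+\mu-\kappa;\,1+2\mu;\,x\right)$, $2\mu\neq-1,-2,\ldots$; for $x<0$ powers and logarithms are taken with the principal branch. $H_n=\sum_{k=1}^n\frac1k$ ($H_0=0$). For integers $s,k$ with $k\ge0$ and $k\ge s$, $$\mathcal{P}(s,k,z)=\sum_{n=0}^{k}\binom{k}{n}(2k-s-n)!\,z^n,\qquad \mathcal{F}(s,k,z)=\sum_{n=0}^{k}(-1)^n\binom{k}{n}\frac{d^{\,n+k-s}}{dz^{\,n+k-s}}\left[\frac{\ln z-\mathrm{Chi}(z)-\mathrm{Shi}(z)+\gamma}{z}\right],$$ where $\gamma$ is Euler's constant, $\mathrm{Shi}(z)=\int_0^z\frac{\sinh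 t}{t}dt$ and $\mathrm{Chi}(z)=\gamma+\ln z+\int_0^z\frac{\cosh t-1}{t}dt$ (same branch of $\ln z$ in both places, so the bracket is an entire function of $z$). *)

(* Defs.v *)
From Stdlib Require Import Reals ZArith Lra.
From Coquelicot Require Import Coquelicot.
Open Scope C_scope.

Definition Cexp (z : C) : C :=
  ((exp (Re z) * cos (Im z))%R, (exp (Re z) * sin (Im z))%R).

(* Principal argument, with values in (-PI, PI]; it is PI on the negative
   real axis. *)
Definition Carg (z : C) : R :=
  if Rlt_dec (Im z) 0 then (- acos (Re z / Cmod z))%R
  else acos (Re z / Cmod z).

Definition Cln (z : C) : C := (ln (Cmod z), Carg z).

Definition Cpower (z w : C) : C := Cexp (w * Cln z).

Definition Csinh (z : C) : C := (Cexp z - Cexp (- z)) / 2.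
Definition Ccosh (z : C) : C := (Cexp z + Cexp (- z)) / 2.

(* [Series] on the real and imaginary parts; see [CSeries_unique]. *)
Definition CSeries (a : nat -> C) : C :=
  (Series (fun n => Re (a n)), Series (fun n => Im (a n))).

Lemma CSeries_unique (a : nat -> C) (s : C) :
  is_series (V := C_NormedModule) a s -> CSeries a = s.
Proof.
  intros Ha.
  assert (Hsum : forall n, sum_n (G := C_AbelianMonoid) a n =
    (sum_n (fun k => Re (a k)) n, sum_n (fun k => Im (a k)) n)).
  { induction n as [|n IH].
    - rewrite !sum_O. now destruct (a O).
    - rewrite !sum_Sn, IH. reflexivity. }
  assert (Hre : is_series (fun k => Re (a k)) (Re s)).
  { intros P [eps HP].
    destruct (Ha (fun y : C => P (Re y))) as [N HN].
    - exists eps. intros y [Hy _]. apply HP. exact Hy.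
    - exists N. intros n Hn. specialize (HN n Hn). cbv beta in HN.
      rewrite Hsum in HN. exact HN. }
  assert (Him : is_series (fun k => Im (a k)) (Im s)).
  { intros P [eps HP].
    destruct (Ha (fun y : C => P (Im y))) as [N HN].
    - exists eps. intros y [_ Hy]. apply HP. exact Hy.
    - exists N. intros n Hn. specialize (HN n Hn). cbv beta in HN.
      rewrite Hsum in HN. exact HN. }
  unfold CSeries.
  rewrite (is_series_unique _ _ Hre), (is_series_unique _ _ Him).
  now destruct s.
Qed.

Fixpoint Cpochhammer (a : C) (n : nat) : C :=
  match n with
  | O => 1
  | S k => Cpochhammer a k * (a + INR k)
  end.

Definition hyp1F1 (a c z : C) : C :=
  CSeries (fun n =>
    Cpochhammer a n / Cpochhammer c n * (z ^ n / INR (fact n))).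

Definition WhittakerM (kappa mu x : C) : C :=
  Cpower x (mu + 1 / 2) * Cexp (- x / 2)
  * hyp1F1 (1 / 2 + mu - kappa) (1 + 2 * mu) x.

Definition harmonic (n : nat) : R := sum_n_m (fun k => / INR k)%R 1 n.

Definition euler_gamma : R :=
  real (Lim_seq (fun n => harmonic n - ln (INR n))%R).

(* Integral of [f] along the segment from 0 to z. *)
Definition CInt0 (f : C -> C) (z : C) : C :=
  RInt (V := C_R_CompleteNormedModule) (fun u : R => z * f (u * z)) 0 1.

(* The integrands are 0 / 0 at the endpoint 0 of the segment, which does not
   affect the integrals. *)
Definition Shi (z : C) : C := CInt0 (fun t => Csinh t / t) z.

Definition Chi (z : C) : C :=
  euler_gamma + Cln z + CInt0 (fun t => (Ccosh t - 1) / t) z.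

Definition C_derive_n (f : C -> C) (n : nat) : C -> C := Nat.iter n C_derive f.

(* In [Pcal] and [Fcal] the intended range is 0 <= k and s <= k, so that all
   arguments of [Z.to_nat] are nonnegative. *)
Definition Pcal (s k : Z) (z : C) : C :=
  sum_n (fun n =>
    Binomial.C (Z.to_nat k) n * INR (fact (Z.to_nat (2 * k - s - Z.of_nat n)))
    * z ^ n) (Z.to_nat k).

(* Entire up to a removable singularity: its value at 0 is the conventional
   0 / 0, so that derivatives are meaningful only away from 0. *)
Definition Fcal_kernel (z : C) : C :=
  (Cln z - Chi z - Shi z + euler_gamma) / z.

Definition Fcal (s k : Z) (z : C) : C :=
  sum_n (fun n =>
    (-1) ^ n * Binomial.C (Z.to_nat k) n
    * C_derive_n Fcal_kernel (Z.to_nat (Z.of_nat n + k - s)) z) (Z.to_nat k).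

(* Main.v *)
(** At [kappa = l/2] and [mu = m + (1-l)/2] the parameters of 1F1 are [N+1] and
    [N+m+2] with [N = m-l], and Euler's integral reads
    [1F1 = (N+m+1)!/(N! m!) I], [I = int_0^1 e^(xt) t^N (1-t)^m dt].
    Differentiating in [mu] multiplies the integrand by [ln t + ln (1-t)], up to
    a multiple of [I] that produces the harmonic numbers. Expanding [(1-t)^m]
    turns the [ln t] part into the derivatives of [int_0^1 e^(xt) ln t dt], which
    is the kernel of [Fcal], and [t -> 1-t] reduces the [ln (1-t)] part to
    the [ln t] part at [-x]; integration by parts gives [I] in terms of [Pcal].

    No integral with a singular integrand is formed: each one is represented by
    its power series in [x], and the splitting [1 = t + (1-t)] under the integral
    by the recurrence [f p q = f (p+1) q + f p (q+1)] of the coefficients. *)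

Require Import Defs.
From Stdlib Require Import Reals ZArith Lra Lia.
From Coquelicot Require Import Coquelicot.
Open Scope C_scope.

(* A complex derivative with quadratic error. The uniform error makes the
   derivative of a series the sum of dominated termwise estimates. *)
Definition qdiff (f : C -> C) (z d : C) : Prop :=
  exists K delta : R, (0 < delta)%R /\ forall h : C, (Cmod h <= delta)%R ->
    (Cmod (f (z + h) - f z - h * d)%C <= K * Cmod h ^ 2)%R.

(** * Calculus rules for derivatives with quadratic error *)

Lemma qdiff_is_derive (f : C -> C) (z d : C) :
  qdiff f z d -> is_derive (K := C_AbsRing) (V := C_NormedModule) f z d.
Proof.
  intros (K & delta & Hdelta & Hf).
  split; [apply is_linear_scal_l |].
  intros y Hy.
  rewrite <- (is_filter_lim_locally_unique (K := C_AbsRing)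
    (V := AbsRing_NormedModule C_AbsRing) z y Hy).
  intros eps.
  assert (HK : (0 <= Rabs K)%R) by apply Rabs_pos.
  assert (Hr : (0 < Rmin delta (eps / (Rabs K + 1)))%R).
  { apply Rmin_pos; [exact Hdelta |].
    apply Rdiv_lt_0_compat; [apply eps | lra]. }
  exists (mkposreal _ Hr). intros w Hw.
  change (Cmod (w - z)%C < Rmin delta (eps / (Rabs K + 1)))%R in Hw.
  change (Cmod (f w - f z - (w - z) * d)%C <= eps * Cmod (w - z)%C)%R.
  pose proof (Rmin_l delta (eps / (Rabs K + 1))) as H1.
  pose proof (Rmin_r delta (eps / (Rabs K + 1))) as H2.
  assert (Hh : (Cmod (w - z)%C <= delta)%R) by lra.
  specialize (Hf (w - z) Hh).
  assert (Hw' : @eq C (z + (w - z)) w) by ring. rewrite Hw' in Hf.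
  apply Rle_trans with (1 := Hf).
  assert (H3 : (Cmod (w - z)%C * (Rabs K + 1) <= eps)%R).
  { apply Rle_trans with (eps / (Rabs K + 1) * (Rabs K + 1))%R.
    - apply Rmult_le_compat_r; lra.
    - right. field. lra. }
  pose proof (Cmod_ge_0 (w - z)) as H4. pose proof (Rle_abs K) as H5. nra.
Qed.

Lemma qdiff_ext (f g : C -> C) (z d : C) :
  (forall w, f w = g w) -> qdiff f z d -> qdiff g z d.
Proof.
  intros Hfg (K & delta & Hdelta & Hf). exists K, delta. split; [exact Hdelta |].
  intros h Hh. rewrite <- !Hfg. now apply Hf.
Qed.

(** The exponent of the complex power is affine in the parameter, and 1F1 is differentiated in its
    displacement from [mu]; both are affine substitutions. The summand 1 in the radius covers
    [a = 0]. *)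
Lemma qdiff_comp_affine (f : C -> C) (a b z d : C) :
  qdiff f (a * z + b) d -> qdiff (fun w => f (a * w + b)) z (a * d).
Proof.
  intros (K & delta & Hdelta & Hf).
  pose proof (Cmod_ge_0 a) as Ha.
  exists (K * Cmod a ^ 2)%R, (delta / (Cmod a + 1))%R.
  split; [apply Rdiv_lt_0_compat; lra |].
  intros h Hh.
  replace (a * (z + h) + b) with (a * z + b + a * h) by ring.
  replace (h * (a * d)) with (a * h * d) by ring.
  apply Rle_trans with (K * Cmod (a * h)%C ^ 2)%R.
  - apply Hf. rewrite Cmod_mult.
    assert (H : (Cmod h * (Cmod a + 1) <= delta)%R).
    { apply Rle_trans with (delta / (Cmod a + 1) * (Cmod a + 1))%R.
      - apply Rmult_le_compat_r; lra.
      - right. field. lra. }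
    pose proof (Cmod_ge_0 h). nra.
  - rewrite Cmod_mult. right. ring.
Qed.

Lemma qdiff_scal (f : C -> C) (c z d : C) :
  qdiff f z d -> qdiff (fun w => c * f w) z (c * d).
Proof.
  intros (K & delta & Hdelta & Hf).
  exists (Cmod c * K)%R, delta. split; [exact Hdelta |]. intros h Hh.
  replace (c * f (z + h) - c * f z - h * (c * d))
    with (c * (f (z + h) - f z - h * d)) by ring.
  rewrite Cmod_mult, Rmult_assoc.
  apply Rmult_le_compat_l; [apply Cmod_ge_0 | now apply Hf].
Qed.

Lemma qdiff_mult (f g : C -> C) (z d e : C) :
  qdiff f z d -> qdiff g z e ->
  qdiff (fun w => f w * g w) z (d * g z + f z * e).
Proof.
  intros (K & r & Hr & Hf) (L & s & Hs & Hg).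
  (* With [F] and [G] the remainders of [f] and [g], the product leaves [F * (g z + h * e + G)],
     [f z * G] and [h * d * (h * e + G)]; the three summands bound these in turn. The radius is
     capped at 1 so that [Cmod h ^ 2 <= Cmod h]. *)
  exists (Rabs K * (Cmod (g z)%C + Cmod e + Rabs L)
    + Cmod (f z)%C * Rabs L + Cmod d * (Cmod e + Rabs L))%R, (Rmin (Rmin r s) 1).
  split; [repeat apply Rmin_pos; lra |]. intros h Hh.
  pose proof (Rmin_l (Rmin r s) 1). pose proof (Rmin_r (Rmin r s) 1).
  pose proof (Rmin_l r s). pose proof (Rmin_r r s).
  assert (Hh1 : (Cmod h <= 1)%R) by lra.
  assert (Hhr : (Cmod h <= r)%R) by lra.
  assert (Hhs : (Cmod h <= s)%R) by lra.
  specialize (Hf h Hhr). specialize (Hg h Hhs).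
  set (F := f (z + h) - f z - h * d) in *.
  set (G := g (z + h) - g z - h * e) in *.
  replace (f (z + h) * g (z + h) - f z * g z - h * (d * g z + f z * e))
    with (F * (g z + h * e + G) + (f z * G + h * (d * (h * e + G))))
    by (unfold F, G; ring).
  pose proof (Cmod_ge_0 h) as h0.
  assert (Hh2 : (Cmod h ^ 2 <= Cmod h)%R) by nra.
  assert (Hh3 : (0 <= Cmod h ^ 2)%R) by nra.
  assert (HF : (Cmod F <= Rabs K * Cmod h ^ 2)%R).
  { pose proof (Rle_abs K). nra. }
  assert (HG : (Cmod G <= Rabs L * Cmod h ^ 2)%R).
  { pose proof (Rle_abs L). nra. }
  pose proof (Rabs_pos L) as HL. pose proof (Rabs_pos K) as HK.
  pose proof (Cmod_ge_0 e). pose proof (Cmod_ge_0 d).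
  pose proof (Cmod_ge_0 (f z)). pose proof (Cmod_ge_0 (g z)).
  assert (HgG : (Cmod (g z + h * e + G)%C <= Cmod (g z)%C + Cmod e + Rabs L)%R).
  { eapply Rle_trans; [apply Cmod_triangle |].
    apply Rplus_le_compat.
    - eapply Rle_trans; [apply Cmod_triangle |]. rewrite Cmod_mult. nra.
    - nra. }
  assert (HeG : (Cmod (h * e + G)%C <= Cmod h * (Cmod e + Rabs L))%R).
  { eapply Rle_trans; [apply Cmod_triangle |]. rewrite Cmod_mult. nra. }
  eapply Rle_trans; [apply Cmod_triangle |].
  rewrite !Rmult_plus_distr_r. rewrite Rplus_assoc.
  apply Rplus_le_compat.
  - rewrite Cmod_mult.
    apply Rle_trans with
      (Rabs K * Cmod h ^ 2 * (Cmod (g z)%C + Cmod e + Rabs L))%R.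
    + apply Rmult_le_compat; try apply Cmod_ge_0; assumption.
    + right. ring.
  - eapply Rle_trans; [apply Cmod_triangle |].
    rewrite !Cmod_mult. apply Rplus_le_compat.
    + rewrite Rmult_assoc. now apply Rmult_le_compat_l.
    + apply Rle_trans with
        (Cmod h * (Cmod d * (Cmod h * (Cmod e + Rabs L))))%R.
      * apply Rmult_le_compat_l; [exact h0 |]. now apply Rmult_le_compat_l.
      * right. ring.
Qed.

(** * Restriction of complex derivatives to real segments *)

Lemma quadratic_remainder_is_derive (f : R -> R) (u d K delta : R) :
  (0 < delta)%R ->
  (forall k, (Rabs k <= delta)%R -> (Rabs (f (u + k) - f u - k * d) <= K * k ^ 2)%R) ->
  is_derive f u d.
Proof.
  intros Hdelta Hf.
  split; [apply is_linear_scal_l |].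
  intros y Hy. rewrite <- (is_filter_lim_locally_unique u y Hy).
  intros eps.
  assert (HK : (0 <= Rabs K)%R) by apply Rabs_pos.
  assert (Hr : (0 < Rmin delta (eps / (Rabs K + 1)))%R).
  { apply Rmin_pos; [exact Hdelta |].
    apply Rdiv_lt_0_compat; [apply eps | lra]. }
  exists (mkposreal _ Hr). intros w Hw.
  change (Rabs (w - u) < Rmin delta (eps / (Rabs K + 1)))%R in Hw.
  change (Rabs (f w - f u - (w - u) * d) <= eps * Rabs (w - u))%R.
  pose proof (Rmin_l delta (eps / (Rabs K + 1))) as H1.
  pose proof (Rmin_r delta (eps / (Rabs K + 1))) as H2.
  assert (Hh : (Rabs (w - u) <= delta)%R) by lra.
  specialize (Hf (w - u)%R Hh).
  assert (Hw' : @eq R (u + (w - u))%R w) by ring. rewrite Hw' in Hf.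
  apply Rle_trans with (1 := Hf).
  assert (H3 : (Rabs (w - u) * (Rabs K + 1) <= eps)%R).
  { apply Rle_trans with (eps / (Rabs K + 1) * (Rabs K + 1))%R.
    - apply Rmult_le_compat_r; lra.
    - right. field. lra. }
  pose proof (Rabs_pos (w - u)) as H4. pose proof (Rle_abs K) as H5.
  rewrite <- pow2_abs. nra.
Qed.

Lemma im_le_Cmod (z : C) : (Rabs (Im z) <= Cmod z)%R.
Proof. eapply Rle_trans; [apply Rmax_r | apply Rmax_Cmod]. Qed.

(** Stated by coordinates because the later arguments on integrals and on constancy along a segment
    concern real functions of a real variable. *)
Lemma qdiff_line (f : C -> C) (z d : C) (u : R) :
  qdiff f (u * z) d ->
  is_derive (fun t : R => Re (f (t * z))%C) u (Re (z * d)%C) /\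
  is_derive (fun t : R => Im (f (t * z))%C) u (Im (z * d)%C).
Proof.
  intros (K & delta & Hdelta & Hf).
  pose proof (Cmod_ge_0 z) as Hz.
  assert (Hr : (0 < delta / (Cmod z + 1))%R) by (apply Rdiv_lt_0_compat; lra).
  assert (H : forall k, (Rabs k <= delta / (Cmod z + 1))%R ->
    (Cmod (f ((u + k)%R * z) - f (u * z) - k * (z * d))%C <= K * Cmod z ^ 2 * k ^ 2)%R).
  { intros k Hk. rewrite RtoC_plus.
    replace ((u + k) * z) with (u * z + k * z) by ring.
    replace (k * (z * d)) with (k * z * d) by ring.
    eapply Rle_trans; [apply Hf |]; rewrite Cmod_mult, Cmod_R.
    - assert (H : (Rabs k * (Cmod z + 1) <= delta)%R).
      { apply Rle_trans with (delta / (Cmod z + 1) * (Cmod z + 1))%R.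
        - apply Rmult_le_compat_r; lra.
        - right. field. lra. }
      pose proof (Rabs_pos k). nra.
    - rewrite Rpow_mult_distr, pow2_abs. right. ring. }
  split; apply (quadratic_remainder_is_derive _ _ _ (K * Cmod z ^ 2)%R _ Hr); intros k Hk.
  - eapply Rle_trans; [| apply (H k Hk)].
    eapply Rle_trans; [| apply re_le_Cmod].
    right. f_equal. destruct d, z. unfold Re, Im. simpl. ring.
  - eapply Rle_trans; [| apply (H k Hk)].
    eapply Rle_trans; [| apply im_le_Cmod].
    right. f_equal. destruct d, z. unfold Re, Im. simpl. ring.
Qed.
(** * Termwise differentiation of complex series *)

Definition summable (a : nat -> C) : Prop := ex_series (fun n => Cmod (a n)).

Lemma summable_le (a : nat -> C) (M : nat -> R) :
  (forall n, (Cmod (a n) <= M n)%R) -> ex_series M -> summable a.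
Proof.
  intros Ha HM. apply (ex_series_le (V := R_CompleteNormedModule) _ M); [| exact HM].
  intros n. change (Rabs (Cmod (a n)) <= M n)%R.
  rewrite Rabs_pos_eq; [apply Ha | apply Cmod_ge_0].
Qed.

Lemma summable_Re (a : nat -> C) : summable a -> ex_series (fun n => Re (a n)).
Proof.
  apply (ex_series_le (V := R_CompleteNormedModule)). intros n. apply re_le_Cmod.
Qed.

Lemma summable_Im (a : nat -> C) : summable a -> ex_series (fun n => Im (a n)).
Proof.
  apply (ex_series_le (V := R_CompleteNormedModule)). intros n. apply im_le_Cmod.
Qed.

Lemma summable_plus (a b : nat -> C) :
  summable a -> summable b -> summable (fun n => a n + b n).
Proof.
  intros Ha Hb.
  apply summable_le with (fun n => Cmod (a n) + Cmod (b n))%R.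
  - intros n. apply Cmod_triangle.
  - now apply (ex_series_plus (V := R_NormedModule)).
Qed.

Lemma summable_scal (c : C) (a : nat -> C) :
  summable a -> summable (fun n => c * a n).
Proof.
  intros Ha. apply summable_le with (fun n => Cmod c * Cmod (a n))%R.
  - intros n. rewrite Cmod_mult. lra.
  - now apply (ex_series_scal_l (K := R_AbsRing) (V:=R_NormedModule)).
Qed.

Lemma CSeries_ext (a b : nat -> C) : (forall n, a n = b n) -> CSeries a = CSeries b.
Proof.
  intros H. unfold CSeries. f_equal; apply Series_ext; intros n; now rewrite H.
Qed.

Lemma CSeries_plus (a b : nat -> C) :
  summable a -> summable b ->
  CSeries (fun n => a n + b n) = CSeries a + CSeries b.
Proof.
  intros Ha Hb. unfold CSeries, Cplus at 3. simpl. f_equal.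
  - rewrite <- Series_plus; [reflexivity | now apply summable_Re | now apply summable_Re].
  - rewrite <- Series_plus; [reflexivity | now apply summable_Im | now apply summable_Im].
Qed.

Lemma CSeries_scal (c : C) (a : nat -> C) :
  summable a -> CSeries (fun n => c * a n) = c * CSeries a.
Proof.
  intros Ha. pose proof (summable_Re a Ha) as Hr. pose proof (summable_Im a Ha) as Hi.
  unfold CSeries, Cmult at 3. simpl. f_equal.
  - rewrite <- !Series_scal_l, <- Series_minus.
    + reflexivity.
    + now apply (ex_series_scal_l (K := R_AbsRing) (V:=R_NormedModule)).
    + now apply (ex_series_scal_l (K := R_AbsRing) (V:=R_NormedModule)).
  - rewrite <- !Series_scal_l, <- Series_plus.
    + reflexivity.
    + now apply (ex_series_scal_l (K := R_AbsRing) (V:=R_NormedModule)).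
    + now apply (ex_series_scal_l (K := R_AbsRing) (V:=R_NormedModule)).
Qed.

Lemma CSeries_incr_1 (a : nat -> C) :
  a O = 0 -> CSeries a = CSeries (fun n => a (S n)).
Proof.
  intros H. unfold CSeries. f_equal; apply Series_incr_1_aux; now rewrite H.
Qed.

Lemma CSeries_RtoC (a : nat -> R) : CSeries (fun n => RtoC (a n)) = Series a.
Proof.
  unfold CSeries. apply injective_projections; [reflexivity |]. simpl.
  rewrite (Series_ext _ (fun _ => 0 * 0)%R) by (intros; simpl; ring).
  rewrite Series_scal_l. ring.
Qed.

(** The majorant bounds the real and the imaginary part separately, whence the factor 2. *)
Lemma Cmod_CSeries_le (a : nat -> C) (M : nat -> R) :
  (forall n, (Cmod (a n) <= M n)%R) -> ex_series M ->
  (Cmod (CSeries a) <= 2 * Series M)%R.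
Proof.
  intros Ha HM.
  assert (H : forall b : nat -> R, (forall n, (Rabs (b n) <= M n)%R) ->
    (Rabs (Series b) <= Series M)%R).
  { intros b Hb. eapply Rle_trans; [apply Series_Rabs |].
    - apply (ex_series_le (V := R_CompleteNormedModule) _ M); [| exact HM].
      intros n. change (Rabs (Rabs (b n)) <= M n)%R. rewrite Rabs_Rabsolu. apply Hb.
    - apply Series_le; [| exact HM]. intros n. split; [apply Rabs_pos | apply Hb]. }
  replace (CSeries a) with
    (RtoC (Series (fun n => Re (a n))) + Ci * RtoC (Series (fun n => Im (a n)))).
  2: { unfold CSeries. apply injective_projections; simpl; ring. }
  eapply Rle_trans; [apply Cmod_triangle |].
  rewrite Cmod_mult, Cmod_Ci, !Cmod_R.
  assert (Hre := H (fun n => Re (a n)) (fun n => Rle_trans _ _ _ (re_le_Cmod _) (Ha n))).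
  assert (Him := H (fun n => Im (a n)) (fun n => Rle_trans _ _ _ (im_le_Cmod _) (Ha n))).
  lra.
Qed.

(** The remainder of the sum is the sum of the remainders, so a summable family [M] of quadratic
    constants on a common disk suffices. *)
Lemma CSeries_qdiff (f : nat -> C -> C) (d : nat -> C) (z : C) (delta : R) (M : nat -> R) :
  (0 < delta)%R -> ex_series M -> summable d ->
  (forall h, (Cmod h <= delta)%R -> summable (fun n => f n (z + h))) ->
  (forall n h, (Cmod h <= delta)%R ->
    (Cmod (f n (z + h) - f n z - h * d n)%C <= M n * Cmod h ^ 2)%R) ->
  qdiff (fun w => CSeries (fun n => f n w)) z (CSeries d).
Proof.
  intros Hdelta HM Hd Hf Hrem.
  exists (2 * Series M)%R, delta. split; [exact Hdelta |]. intros h Hh.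
  assert (Hz : summable (fun n => f n z)).
  { assert (H0 : (Cmod 0 <= delta)%R) by (rewrite Cmod_0; lra).
    generalize (Hf _ H0). apply ex_series_ext. intros n.
    now rewrite Cplus_0_r. }
  replace (CSeries (fun n => f n (z + h)) - CSeries (fun n => f n z) - h * CSeries d)
    with (CSeries (fun n => f n (z + h) + (- (1) * f n z + - h * d n))).
  2: { rewrite CSeries_plus, CSeries_plus, !CSeries_scal; auto using summable_plus, summable_scal.
       ring. }
  apply Rle_trans with (2 * Series (fun n => M n * Cmod h ^ 2))%R.
  - apply Cmod_CSeries_le.
    + intros n. replace (f n (z + h) + (- (1) * f n z + - h * d n))
        with (f n (z + h) - f n z - h * d n) by ring.
      now apply Hrem.
    + apply (ex_series_ext (fun n => Cmod h ^ 2 * M n)%R).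
      { intros n. apply Rmult_comm. }
      now apply (ex_series_scal_l (K := R_AbsRing) (V:=R_NormedModule)).
  - rewrite Series_scal_r. lra.
Qed.

Lemma ex_series_exp (D : R) : ex_series (fun n => / INR (fact n) * D ^ n)%R.
Proof.
  exists (exp D). generalize (is_exp_Reals D). apply is_series_ext. intros n.
  rewrite pow_n_pow. apply Rmult_comm.
Qed.

(** * Products of variable factors, and series of such products *)

Fixpoint cprod (u : nat -> C) (n : nat) : C :=
  match n with O => 1 | S k => cprod u k * u k end.

(** The Leibniz rule as a recursion: [alpha] holds the values of the factors, [beta] their
    derivatives. *)
Fixpoint cprod_deriv (alpha beta : nat -> C) (n : nat) : C :=
  match n with
  | O => 0
  | S k => cprod_deriv alpha beta k * alpha k + cprod alpha k * beta k
  end.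

Lemma cprod_ext (u v : nat -> C) (n : nat) :
  (forall k, u k = v k) -> cprod u n = cprod v n.
Proof. intros H. induction n as [| n IH]; [reflexivity |]. simpl. now rewrite IH, H. Qed.

Lemma cprod_deriv_ext (a b beta : nat -> C) (n : nat) :
  (forall k, a k = b k) -> cprod_deriv a beta n = cprod_deriv b beta n.
Proof.
  intros H. induction n as [| n IH]; [reflexivity |].
  simpl. now rewrite IH, H, (cprod_ext a b n H).
Qed.

Section ProductBound.

Variables (u : nat -> C -> C) (beta : nat -> C) (z : C) (A B K delta : R).
Hypothesis Hdelta : (delta <= 1)%R.
Hypothesis HA : forall n, (Cmod (u n z) <= A)%R.
Hypothesis HB : forall n, (Cmod (beta n) <= B)%R.
Hypothesis HK : (0 <= K)%R.
Hypothesis Hu : forall n h, (Cmod h <= delta)%R ->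
  (Cmod (u n (z + h) - u n z - h * beta n)%C <= K * Cmod h ^ 2)%R.

Let alpha n := u n z.
(** Makes the remainder bound inductive: one more factor costs [A + B + K] for its value at [z + h],
    [B] for the second-order cross term and [2 * K] for its own remainder. *)
Let D := (A + 2 * B + 3 * K)%R.

Lemma cprod_A_ge0 : (0 <= A)%R.
Proof. eapply Rle_trans; [apply Cmod_ge_0 | apply (HA 0)]. Qed.

Lemma cprod_B_ge0 : (0 <= B)%R.
Proof. eapply Rle_trans; [apply Cmod_ge_0 | apply (HB 0)]. Qed.

Lemma cprod_D_pow_ge0 n : (0 <= D ^ n)%R.
Proof.
  apply pow_le. pose proof cprod_A_ge0. pose proof cprod_B_ge0. unfold D. lra.
Qed.

Lemma cprod_factor_le n h :
  (Cmod h <= delta)%R -> (Cmod (u n (z + h)%C) <= A + B + K)%R.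
Proof.
  intros Hh. pose proof (Hu n h Hh) as H. pose proof (Cmod_ge_0 h) as h0.
  replace (u n (z + h)) with
    (u n z + h * beta n + (u n (z + h) - u n z - h * beta n)) by ring.
  pose proof (HA n). pose proof (HB n). pose proof (Cmod_ge_0 (beta n)).
  eapply Rle_trans; [apply Cmod_triangle |]. apply Rplus_le_compat.
  - eapply Rle_trans; [apply Cmod_triangle |]. rewrite Cmod_mult. nra.
  - assert (Cmod h ^ 2 <= 1)%R by nra. nra.
Qed.

Lemma cprod_le n h :
  (Cmod h <= delta)%R -> (Cmod (cprod (fun k => u k (z + h)%C) n) <= D ^ n)%R.
Proof.
  intros Hh. induction n as [| n IH]; simpl.
  - rewrite Cmod_1. lra.
  - rewrite Cmod_mult, Rmult_comm. apply Rmult_le_compat; try apply Cmod_ge_0.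
    + eapply Rle_trans; [now apply cprod_factor_le |].
      pose proof cprod_B_ge0. unfold D. lra.
    + exact IH.
Qed.

Lemma cprod_base_le n : (Cmod (cprod alpha n) <= D ^ n)%R.
Proof.
  induction n as [| n IH]; simpl.
  - rewrite Cmod_1. lra.
  - rewrite Cmod_mult, Rmult_comm. apply Rmult_le_compat; try apply Cmod_ge_0.
    + eapply Rle_trans; [apply HA |]. pose proof cprod_B_ge0. unfold D. lra.
    + exact IH.
Qed.

Lemma cprod_deriv_le n : (Cmod (cprod_deriv alpha beta n) <= D ^ n)%R.
Proof.
  induction n as [| n IH]; simpl.
  - rewrite Cmod_0. lra.
  - eapply Rle_trans; [apply Cmod_triangle |]. rewrite !Cmod_mult.
    pose proof (cprod_base_le n) as Hp. pose proof (cprod_D_pow_ge0 n) as H0.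
    pose proof cprod_A_ge0. pose proof cprod_B_ge0.
    apply Rle_trans with (D ^ n * A + D ^ n * B)%R.
    + apply Rplus_le_compat; apply Rmult_le_compat; try apply Cmod_ge_0; auto.
      apply HA.
    + unfold D at 3. nra.
Qed.

Lemma cprod_remainder_le n h :
  (Cmod h <= delta)%R ->
  (Cmod (cprod (fun k => u k (z + h)%C) n - cprod alpha n
    - h * cprod_deriv alpha beta n)%C <= D ^ n * Cmod h ^ 2)%R.
Proof.
  intros Hh. pose proof (Cmod_ge_0 h) as h0.
  induction n as [| n IH]; simpl.
  - replace (1 - 1 - h * 0) with (RtoC 0) by ring. rewrite Cmod_0. nra.
  - set (P := cprod (fun k => u k (z + h)) n) in *.
    set (p := cprod alpha n) in *. set (q := cprod_deriv alpha beta n) in *.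
    set (r := u n (z + h) - u n z - h * beta n).
    assert (Hr : (Cmod r <= K * Cmod h ^ 2)%R) by now apply Hu.
    replace (P * u n (z + h) - p * alpha n - h * (q * alpha n + p * beta n))
      with ((P - p - h * q) * u n (z + h) + (h ^ 2 * (q * beta n) + (p + h * q) * r))
      by (unfold r, alpha; ring).
    pose proof (cprod_factor_le n h Hh) as HU.
    assert (Hp : (Cmod p <= D ^ n)%R) by apply cprod_base_le.
    assert (Hq : (Cmod q <= D ^ n)%R) by apply cprod_deriv_le.
    pose proof (cprod_D_pow_ge0 n) as H0.
    pose proof cprod_A_ge0 as HA0. pose proof cprod_B_ge0 as HB0.
    assert (Hpq : (Cmod (p + h * q)%C <= 2 * D ^ n)%R).
    { eapply Rle_trans; [apply Cmod_triangle |]. rewrite Cmod_mult.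
      pose proof (Cmod_ge_0 q). nra. }
    set (E := (D ^ n)%R) in *. set (H2 := (Cmod h ^ 2)%R) in *.
    assert (H20 : (0 <= H2)%R) by (unfold H2; nra).
    fold H2. change (Cmod h * (Cmod h * 1))%R with H2.
    apply Rle_trans with (E * H2 * (A + B + K) + (H2 * (E * B) + 2 * E * (K * H2)))%R.
    2: { right. unfold D. ring. }
    eapply Rle_trans; [apply Cmod_triangle |]. apply Rplus_le_compat.
    + rewrite Cmod_mult. apply Rmult_le_compat; try apply Cmod_ge_0; assumption.
    + eapply Rle_trans; [apply Cmod_triangle |]. apply Rplus_le_compat.
      * rewrite Cmod_mult, Cmod_pow. apply Rmult_le_compat_l; [exact H20 |].
        rewrite Cmod_mult. apply Rmult_le_compat; try apply Cmod_ge_0; auto.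
      * rewrite Cmod_mult. apply Rmult_le_compat; try apply Cmod_ge_0; assumption.
Qed.

(** The factorial decay of [w] absorbs the geometric growth [D ^ n], leaving an exponential series
    as majorant. Factors equal to the variable give power series, and Mobius factors give 1F1 as a
    function of its parameters. *)
Lemma cprod_series_qdiff (w : nat -> C) (W : R) :
  (0 < delta)%R -> (forall n, (Cmod (w n) <= / INR (fact n) * W ^ n)%R) ->
  qdiff (fun y => CSeries (fun n => w n * cprod (fun k => u k y) n)) z
    (CSeries (fun n => w n * cprod_deriv alpha beta n)).
Proof.
  intros Hdelta0 Hw.
  assert (HM : forall a : nat -> C, (forall n, (Cmod (a n) <= D ^ n)%R) ->
    forall n, (Cmod (w n * a n)%C <= / INR (fact n) * (W * D) ^ n)%R).
  { intros a Ha n. rewrite Cmod_mult, Rpow_mult_distr, <- Rmult_assoc.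
    apply Rmult_le_compat; try apply Cmod_ge_0; auto. }
  apply CSeries_qdiff with delta (fun n => / INR (fact n) * (W * D) ^ n)%R.
  - exact Hdelta0.
  - apply ex_series_exp.
  - eapply summable_le; [apply HM, cprod_deriv_le | apply ex_series_exp].
  - intros h Hh. eapply summable_le; [| apply ex_series_exp].
    apply HM. intros n. now apply cprod_le.
  - intros n h Hh.
    replace (w n * cprod (fun k => u k (z + h)) n - w n * cprod (fun k => u k z) n
      - h * (w n * cprod_deriv alpha beta n))
      with (w n * (cprod (fun k => u k (z + h)) n - cprod alpha n
        - h * cprod_deriv alpha beta n)) by (unfold alpha; ring).
    rewrite Cmod_mult, Rpow_mult_distr, <- Rmult_assoc, Rmult_assoc.
    apply Rmult_le_compat; try apply Cmod_ge_0; auto.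
    now apply cprod_remainder_le.
Qed.

End ProductBound.
(** * Exponential generating functions *)

(** This bound is stable under shifts of the index, hence under differentiation of [egf], and the
    moments [beta_coeff] and [log_coeff] satisfy it. *)
Definition unit_bounded (w : nat -> R) : Prop := forall n, (Rabs (w n) <= 1)%R.

Definition egf (w : nat -> R) (z : C) : C :=
  CSeries (fun n => (w n * / INR (fact n))%R * z ^ n).

Lemma fact_inv_ge0 n : (0 <= / INR (fact n))%R.
Proof. apply Rlt_le, Rinv_0_lt_compat, INR_fact_lt_0. Qed.

Lemma egf_coeff_le (w : nat -> R) (n : nat) :
  unit_bounded w -> (Rabs (w n * / INR (fact n)) <= / INR (fact n))%R.
Proof.
  intros Hw. rewrite Rabs_mult. rewrite (Rabs_pos_eq (/ _)) by apply fact_inv_ge0.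
  pose proof (Hw n). pose proof (fact_inv_ge0 n). nra.
Qed.

Lemma egf_summable (w : nat -> R) (z : C) :
  unit_bounded w -> summable (fun n => (w n * / INR (fact n))%R * z ^ n).
Proof.
  intros Hw. eapply summable_le; [| apply (ex_series_exp (Cmod z))].
  intros n. cbv beta. rewrite Cmod_mult, Cmod_R, Cmod_pow.
  apply Rmult_le_compat_r; [apply pow_le, Cmod_ge_0 | now apply egf_coeff_le].
Qed.

Lemma cprod_const (z : C) n : cprod (fun _ => z) n = z ^ n.
Proof. induction n as [| n IH]; [reflexivity |]. simpl. rewrite IH. ring. Qed.

Lemma cprod_deriv_const (z : C) n :
  cprod_deriv (fun _ => z) (fun _ => RtoC 1) (S n) = INR (S n) * z ^ n.
Proof.
  induction n as [| n IH]; [simpl; ring |].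
  change (cprod_deriv (fun _ => z) (fun _ => RtoC 1) (S n) * z
    + cprod (fun _ => z) (S n) * 1 = INR (S (S n)) * z ^ S n).
  rewrite IH, cprod_const, (S_INR (S n)), RtoC_plus, Cpow_S. ring.
Qed.

(** Since n z^(n-1) / n! = z^(n-1) / (n-1)!, differentiation shifts the weights. The product
    estimate is used with [A = Cmod z], [B = 1], [K = 0] on the disk of radius 1. *)
Lemma egf_qdiff (w : nat -> R) (z : C) :
  unit_bounded w -> qdiff (egf w) z (egf (fun n => w (S n)) z).
Proof.
  intros Hw.
  pose proof (cprod_series_qdiff (fun _ y => y) (fun _ => RtoC 1) z (Cmod z) 1 0 1
    (Rle_refl 1) (fun _ => Rle_refl _)) as H.
  assert (H1 : forall n : nat, (Cmod 1 <= 1)%R) by (intros; rewrite Cmod_1; lra).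
  specialize (H H1 (Rle_refl 0)).
  assert (Hu : forall (n : nat) h, (Cmod h <= 1)%R ->
    (Cmod (z + h - z - h * 1)%C <= 0 * Cmod h ^ 2)%R).
  { intros n h _. replace (z + h - z - h * 1) with (RtoC 0) by ring.
    rewrite Cmod_0. lra. }
  specialize (H Hu (fun n => RtoC (w n * / INR (fact n))%R) 1%R Rlt_0_1).
  assert (Hc : forall n,
    (Cmod (w n * / INR (fact n))%R <= / INR (fact n) * 1 ^ n)%R).
  { intros n. rewrite Cmod_R, pow1, Rmult_1_r. now apply egf_coeff_le. }
  specialize (H Hc).
  replace (egf (fun n => w (S n)) z) with
    (CSeries (fun n => (w n * / INR (fact n))%R
      * cprod_deriv (fun _ => z) (fun _ => RtoC 1) n)).
  - revert H. apply qdiff_ext. intros y. apply CSeries_ext. intros n.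
    now rewrite cprod_const.
  - rewrite CSeries_incr_1 by (simpl; ring). apply CSeries_ext. intros n.
    rewrite cprod_deriv_const, Cmult_assoc, <- RtoC_mult.
    f_equal. f_equal. rewrite fact_simpl, mult_INR.
    pose proof (INR_fact_neq_0 n). field. split; [assumption |].
    apply not_0_INR. discriminate.
Qed.

Lemma egf_mult_var (w v : nat -> R) (z : C) :
  unit_bounded w -> v O = 0%R -> (forall n, v (S n) = INR (S n) * w n)%R ->
  egf v z = z * egf w z.
Proof.
  intros Hw H0 HS. unfold egf.
  rewrite <- CSeries_scal by now apply egf_summable.
  rewrite CSeries_incr_1 by (rewrite H0, Rmult_0_l; ring).
  apply CSeries_ext. intros n. rewrite HS, fact_simpl, mult_INR, Cpow_S.
  replace (INR (S n) * w n * / (INR (S n) * INR (fact n)))%R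
    with (w n * / INR (fact n))%R.
  - ring.
  - pose proof (INR_fact_neq_0 n). field. split; [assumption |].
    apply not_0_INR. discriminate.
Qed.

Lemma egf_0 (w : nat -> R) : egf w 0 = w O.
Proof.
  unfold egf.
  rewrite (CSeries_ext _ (fun n => RtoC (match n with O => w O | S _ => 0%R end))).
  - rewrite CSeries_RtoC. f_equal. rewrite Series_incr_1.
    + rewrite (Series_ext _ (fun n => 0 * 0)%R) by (intros; ring).
      rewrite Series_scal_l. ring.
    + apply ex_series_incr_1.
      apply (ex_series_ext (fun n => 0 * (/ INR (fact n) * 0 ^ n))%R); [intros; apply Rmult_0_l |].
      apply (ex_series_scal_l (K := R_AbsRing) (V := R_NormedModule)), ex_series_exp.
  - intros [| n]; simpl.
    + rewrite Rinv_1, Rmult_1_r. ring.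
    + ring.
Qed.

(** * The complex exponential and its power series *)

Lemma Cexp_plus (z w : C) : Cexp (z + w) = Cexp z * Cexp w.
Proof.
  destruct z as [a b], w as [c d]. unfold Cexp, Cplus, Cmult. simpl.
  rewrite exp_plus, cos_plus, sin_plus. f_equal; ring.
Qed.

Lemma Cexp_0 : Cexp 0 = 1.
Proof. apply injective_projections; simpl; rewrite exp_0, ?cos_0, ?sin_0; ring. Qed.

Lemma Cexp_RtoC (x : R) : Cexp x = exp x.
Proof. apply injective_projections; simpl; rewrite ?cos_0, ?sin_0; ring. Qed.

Lemma unit_bounded_1 : unit_bounded (fun _ => 1%R).
Proof. intros n. rewrite Rabs_R1. lra. Qed.

(** Covers both coordinates of a product of complex-valued functions: the real part with [c = -1],
    the imaginary part with [c = 1]. *)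
Lemma is_derive_mult_plus_mult (p q r s : R -> R) (x c dp dq dr ds : R) :
  is_derive p x dp -> is_derive q x dq -> is_derive r x dr -> is_derive s x ds ->
  is_derive (fun t => p t * q t + c * (r t * s t))%R x
    (dp * q x + p x * dq + c * (dr * s x + r x * ds))%R.
Proof.
  intros Hp Hq Hr Hs.
  apply (is_derive_plus (K := R_AbsRing) (V := R_NormedModule)
    (fun t => p t * q t)%R (fun t => c * (r t * s t))%R).
  - exact (is_derive_mult p q x dp dq Hp Hq Rmult_comm).
  - apply (is_derive_scal (fun t => r t * s t)%R).
    exact (is_derive_mult r s x dr ds Hr Hs Rmult_comm).
Qed.

(* [u |-> egf 1 (u z) exp(-u z)] has zero derivative along the segment from 0 to z. *)
Lemma Cexp_egf (z : C) : Cexp z = egf (fun _ => 1%R) z.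
Proof.
  set (E := egf (fun _ => 1%R)).
  assert (HE : forall u : R, is_derive (fun t : R => Re (E (t * z))) u (Re (z * E (u * z))) /\
    is_derive (fun t : R => Im (E (t * z))) u (Im (z * E (u * z)))).
  { intros u. apply qdiff_line, (egf_qdiff _ _ unit_bounded_1). }
  destruct z as [a b].
  set (F := fun t : R => Cexp (- (t * (a, b)))).
  set (r := fun t : R => (Re (E (t * (a, b))%C) * Re (F t)
    - Im (E (t * (a, b))%C) * Im (F t))%R).
  set (i := fun t : R => (Re (E (t * (a, b))%C) * Im (F t)
    + Im (E (t * (a, b))%C) * Re (F t))%R).
  assert (HF : forall u : R, is_derive (fun t : R => Re (F t)) u (Re (- (a, b) * F u)) /\
    is_derive (fun t : R => Im (F t)) u (Im (- (a, b) * F u))).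
  { intros u. unfold F, Cexp, Re, Im. simpl. split; auto_derive; trivial; unfold Rminus; ring. }
  assert (Hr : r 0%R = r 1%R).
  { apply (eq_is_derive (V := R_NormedModule)); [| lra]. intros t _.
    destruct (HE t) as [H1 H2], (HF t) as [H3 H4].
    unfold r.
    eapply is_derive_ext; [| evar_last; [exact (is_derive_mult_plus_mult _ _ _ _ t (-1) _ _ _ _ H1 H3 H2 H4) |]].
    - intros u. simpl. ring.
    - unfold Re, Im. simpl. unfold zero. simpl. ring. }
  assert (Hi : i 0%R = i 1%R).
  { apply (eq_is_derive (V := R_NormedModule)); [| lra]. intros t _.
    destruct (HE t) as [H1 H2], (HF t) as [H3 H4].
    unfold i.
    eapply is_derive_ext; [| evar_last; [exact (is_derive_mult_plus_mult _ _ _ _ t 1 _ _ _ _ H1 H4 H2 H3) |]].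
    - intros u. simpl. ring.
    - unfold Re, Im. simpl. unfold zero. simpl. ring. }
  assert (H : forall t : R, E (t * (a, b)) * F t = (r t, i t)) by reflexivity.
  assert (H1 : E (a, b) * Cexp (- (a, b)) = 1).
  { replace (a, b) with (RtoC 1 * (a, b)) by ring. fold (F 1%R).
    rewrite H, <- Hr, <- Hi, <- H. unfold F.
    rewrite Cmult_0_l, Copp_0, Cexp_0. unfold E. rewrite egf_0. ring. }
  rewrite <- (Cmult_1_l (Cexp (a, b))), <- H1, <- Cmult_assoc, <- Cexp_plus.
  replace (- (a, b) + (a, b)) with (RtoC 0) by ring. rewrite Cexp_0. ring.
Qed.

Lemma Cexp_qdiff (z : C) : qdiff Cexp z (Cexp z).
Proof.
  rewrite (Cexp_egf z). apply (qdiff_ext (egf (fun _ => 1%R))).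
  - intros w. symmetry. apply Cexp_egf.
  - apply (egf_qdiff _ _ unit_bounded_1).
Qed.
(** * Arrays with the Pascal recurrence *)

Definition pascal_array (f : nat -> nat -> R) : Prop :=
  forall p q, (f p q = f (S p) q + f p (S q))%R.

(** Partial sums allow induction on [M] with [N] fixed. The boundary term is kept apart because
    [Binomial.C N n] does not vanish for [n > N], so Pascal's rule holds only inside the range. *)
Lemma binomial_sum_partial (f : nat -> R) (N M : nat) : (M <= N)%nat ->
  (sum_n (fun n => Binomial.C (S N) n * f n) M + Binomial.C N M * f (S M)
   = sum_n (fun n => Binomial.C N n * (f n + f (S n))) M)%R.
Proof.
  induction M as [| M IH]; intros HM.
  - rewrite !sum_O, !C_n_0. ring.
  - rewrite !sum_Sn. unfold plus. simpl.
    rewrite <- IH by lia. rewrite <- (pascal N M) by lia. ring.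
Qed.

Lemma binomial_sum_S (f : nat -> R) (N : nat) :
  (sum_n (fun n => Binomial.C (S N) n * f n) (S N)
   = sum_n (fun n => Binomial.C N n * (f n + f (S n))) N)%R.
Proof.
  rewrite <- binomial_sum_partial by lia.
  rewrite sum_Sn. unfold plus. simpl. now rewrite !C_n_n.
Qed.

Lemma sum_n_Rplus (a b : nat -> R) n :
  sum_n (fun k => a k + b k)%R n = (sum_n a n + sum_n b n)%R.
Proof. exact (sum_n_plus (G := R_AbelianGroup) a b n). Qed.

Lemma sum_n_Rmult_l (c : R) (a : nat -> R) n :
  sum_n (fun k => c * a k)%R n = (c * sum_n a n)%R.
Proof. exact (sum_n_scal_l (K := R_Ring) (V := R_ModuleSpace) c a n). Qed.

Lemma sum_n_R_ext (a b : nat -> R) n :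
  (forall k, (k <= n)%nat -> a k = b k) -> sum_n a n = sum_n b n.
Proof. apply (sum_n_ext_loc (G := R_AbelianMonoid)). Qed.

(** The binomial expansion of (1-t)^r under the integral. Each splitting raises [p], so the
    induction on [r] is for all [p]. *)
Lemma pascal_array_expand (f : nat -> nat -> R) (p q r : nat) :
  pascal_array f ->
  f p (q + r)%nat = sum_n (fun k => Binomial.C r k * ((-1) ^ k * f (p + k)%nat q))%R r.
Proof.
  intros Hf. revert p. induction r as [| r IH]; intros p.
  - rewrite sum_O, C_n_0, !Nat.add_0_r. ring.
  - rewrite binomial_sum_S.
    rewrite (sum_n_ext _ (fun k => Binomial.C r k * ((-1) ^ k * f (p + k)%nat q)
      + -1 * (Binomial.C r k * ((-1) ^ k * f (S p + k)%nat q)))%R).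
    + rewrite sum_n_Rplus, sum_n_Rmult_l, <- !IH, Nat.add_succ_r, (Hf p (q + r)%nat). ring.
    + intros k. simpl. rewrite Nat.add_succ_r. ring.
Qed.

(* [int_0^1 t^p (1-t)^q dt] *)
Definition beta_coeff (p q : nat) : R := (INR (fact p) * INR (fact q) / INR (fact (p + q + 1)))%R.

(* [int_0^1 t^p (1-t)^q ln t dt] *)
Definition log_coeff (p q : nat) : R :=
  (beta_coeff p q * (harmonic p - harmonic (p + q + 1)))%R.

Lemma harmonic_S n : harmonic (S n) = (harmonic n + / INR (S n))%R.
Proof. unfold harmonic. now rewrite sum_n_Sm by lia. Qed.

Lemma beta_coeff_pos p q : (0 < beta_coeff p q)%R.
Proof.
  unfold beta_coeff. apply Rdiv_lt_0_compat; [apply Rmult_lt_0_compat |];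
    apply INR_fact_lt_0.
Qed.

Lemma beta_coeff_Sl p q :
  (beta_coeff (S p) q = beta_coeff p q * (INR p + 1) / (INR p + INR q + 2))%R.
Proof.
  unfold beta_coeff. replace (S p + q + 1)%nat with (S (p + q + 1)) by lia.
  rewrite !fact_simpl, !mult_INR, !S_INR, !plus_INR. simpl (INR 1).
  pose proof (INR_fact_neq_0 (p + q + 1)). pose proof (pos_INR p). pose proof (pos_INR q).
  field. split; lra.
Qed.

Lemma beta_coeff_Sr p q :
  (beta_coeff p (S q) = beta_coeff p q * (INR q + 1) / (INR p + INR q + 2))%R.
Proof.
  unfold beta_coeff. replace (p + S q + 1)%nat with (S (p + q + 1)) by lia.
  rewrite !fact_simpl, !mult_INR, !S_INR, !plus_INR. simpl (INR 1).
  pose proof (INR_fact_neq_0 (p + q + 1)). pose proof (pos_INR p). pose proof (pos_INR q).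
  field. split; lra.
Qed.

Lemma beta_coeff_0_r p : beta_coeff p 0 = (/ INR (S p))%R.
Proof.
  unfold beta_coeff. replace (p + 0 + 1)%nat with (S p) by lia.
  rewrite fact_simpl, mult_INR. change (fact 0) with 1%nat. rewrite INR_1.
  pose proof (INR_fact_neq_0 p). assert (INR (S p) <> 0%R) by (apply not_0_INR; discriminate).
  field. now split.
Qed.

Lemma beta_coeff_pascal : pascal_array beta_coeff.
Proof.
  intros p q. rewrite beta_coeff_Sl, beta_coeff_Sr.
  pose proof (pos_INR p). pose proof (pos_INR q). field. lra.
Qed.

Lemma log_coeff_pascal : pascal_array log_coeff.
Proof.
  intros p q. unfold log_coeff. rewrite beta_coeff_Sl, beta_coeff_Sr.
  replace (S p + q + 1)%nat with (S (p + q + 1)) by lia.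
  replace (p + S q + 1)%nat with (S (p + q + 1)) by lia.
  rewrite !harmonic_S, !S_INR, !plus_INR. simpl (INR 1).
  pose proof (pos_INR p). pose proof (pos_INR q). field. split; lra.
Qed.

Lemma log_coeff_0_r p : log_coeff p 0 = (- (/ INR (S p)) ^ 2)%R.
Proof.
  unfold log_coeff. rewrite beta_coeff_0_r.
  replace (p + 0 + 1)%nat with (S p) by lia. rewrite harmonic_S. ring.
Qed.

Lemma Rinv_INR_S_bounds n : (0 < / INR (S n) <= 1)%R.
Proof.
  assert (H : (1 <= INR (S n))%R) by (rewrite S_INR; pose proof (pos_INR n); lra).
  split; [apply Rinv_0_lt_compat; lra |].
  rewrite <- Rinv_1. apply Rinv_le_contravar; lra.
Qed.

Lemma harmonic_le p r : (harmonic p <= harmonic (p + r))%R.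
Proof.
  induction r as [| r IH].
  - rewrite Nat.add_0_r. lra.
  - rewrite Nat.add_succ_r, harmonic_S. pose proof (Rinv_INR_S_bounds (p + r)). lra.
Qed.

(** By the recurrence and positivity, raising [q] only decreases the value, starting from
    [/ INR (S p)] at [q = 0]. *)
Lemma beta_coeff_le_1 p q : (Rabs (beta_coeff p q) <= 1)%R.
Proof.
  rewrite Rabs_pos_eq by apply Rlt_le, beta_coeff_pos.
  induction q as [| q IH].
  - rewrite beta_coeff_0_r. apply Rinv_INR_S_bounds.
  - pose proof (beta_coeff_pascal p q). pose proof (beta_coeff_pos (S p) q). lra.
Qed.

Lemma log_coeff_nonpos p q : (log_coeff p q <= 0)%R.
Proof.
  unfold log_coeff. pose proof (beta_coeff_pos p q).
  pose proof (harmonic_le p (q + 1)) as H1. rewrite Nat.add_assoc in H1. nra.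
Qed.

Lemma log_coeff_le_1 p q : (Rabs (log_coeff p q) <= 1)%R.
Proof.
  rewrite Rabs_left1 by apply log_coeff_nonpos.
  induction q as [| q IH].
  - rewrite log_coeff_0_r. pose proof (Rinv_INR_S_bounds p). nra.
  - pose proof (log_coeff_pascal p q). pose proof (log_coeff_nonpos (S p) q). lra.
Qed.

(** If [f p q] is the integral of t^p (1-t)^q phi(t) over [0,1], then the weights [f (p + n) q] give
    the integral of e^(xt) t^p (1-t)^q phi(t), and the weights [f p (q + n)] the same with
    e^(x(1-t)). *)
Definition regf (w : nat -> R) (x : R) : R :=
  Series (fun n => w n * / INR (fact n) * x ^ n)%R.

Lemma egf_RtoC (w : nat -> R) (x : R) : egf w x = regf w x.
Proof.
  unfold egf, regf. rewrite <- CSeries_RtoC. apply CSeries_ext. intros n.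
  now rewrite (RtoC_mult (_ * _)), RtoC_pow.
Qed.

Lemma regf_ext (v w : nat -> R) (x : R) : (forall n, v n = w n) -> regf v x = regf w x.
Proof. intros H. apply Series_ext. intros n. now rewrite H. Qed.

Lemma ex_series_regf_abs (w : nat -> R) (x : R) :
  unit_bounded w -> ex_series (fun n => Rabs (w n * / INR (fact n) * x ^ n)).
Proof.
  intros Hw. eapply (ex_series_le (V := R_CompleteNormedModule));
    [| apply (ex_series_exp (Rabs x))].
  intros n. change (Rabs (Rabs (w n * / INR (fact n) * x ^ n)) <= / INR (fact n) * Rabs x ^ n)%R.
  rewrite Rabs_Rabsolu, Rabs_mult, <- RPow_abs.
  apply Rmult_le_compat_r; [apply pow_le, Rabs_pos | now apply egf_coeff_le].
Qed.

Lemma ex_series_regf (w : nat -> R) (x : R) :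
  unit_bounded w -> ex_series (fun n => w n * / INR (fact n) * x ^ n)%R.
Proof. intros Hw. now apply ex_series_Rabs, ex_series_regf_abs. Qed.

Lemma regf_plus (v w : nat -> R) (x : R) :
  ex_series (fun n => v n * / INR (fact n) * x ^ n)%R ->
  ex_series (fun n => w n * / INR (fact n) * x ^ n)%R ->
  regf (fun n => v n + w n)%R x = (regf v x + regf w x)%R.
Proof.
  intros Hv Hw. unfold regf. rewrite <- Series_plus by assumption.
  apply Series_ext. intros n. ring.
Qed.

Lemma regf_scal (c : R) (w : nat -> R) (x : R) :
  regf (fun n => c * w n)%R x = (c * regf w x)%R.
Proof.
  unfold regf. rewrite <- Series_scal_l. apply Series_ext. intros n. ring.
Qed.

Lemma regf_1 (x : R) : regf (fun _ => 1%R) x = exp x.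
Proof.
  unfold regf. apply is_series_unique.
  generalize (is_exp_Reals x). apply is_series_ext. intros n.
  rewrite pow_n_pow. unfold scal. simpl. unfold mult. simpl. ring.
Qed.

(** Hence [pascal_array_expand] applies to the integrals with the factor e^(xt) as well as to their
    coefficients. *)
Lemma regf_pascal_array (f : nat -> nat -> R) (x : R) :
  pascal_array f -> (forall p q, (Rabs (f p q) <= 1)%R) ->
  pascal_array (fun p q => regf (fun n => f (p + n)%nat q) x).
Proof.
  intros Hf Hb p q. rewrite <- regf_plus by (apply ex_series_regf; intros n; apply Hb).
  apply regf_ext. intros n. apply Hf.
Qed.

(* With [f p q] the integral of [t^p (1-t)^q phi(t)] over [0,1], this is the
   substitution [t := 1 - t] in the integral of [exp (x t) t^q (1-t)^p phi(1-t)]. *)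
Lemma regf_kummer (f : nat -> nat -> R) (p q : nat) (x : R) :
  pascal_array f -> (forall p q, (Rabs (f p q) <= 1)%R) ->
  regf (fun n => f p (q + n)%nat) x = (exp x * regf (fun n => f (p + n)%nat q) (- x))%R.
Proof.
  intros Hf Hb. rewrite <- (regf_1 x), Rmult_comm. unfold regf at 1.
  apply is_series_unique.
  assert (Hp : unit_bounded (fun n => f (p + n)%nat q)) by (intros n; apply Hb).
  (* In the Cauchy product, the coefficient of x^n is the expansion of (1-t)^n in [f p (q + n)]; the
     signs come from the powers of [- x]. *)
  generalize (is_series_mult _ _ _ _
    (Series_correct _ (ex_series_regf _ (- x) Hp))
    (Series_correct _ (ex_series_regf _ x unit_bounded_1))
    (ex_series_regf_abs _ (- x) Hp) (ex_series_regf_abs _ x unit_bounded_1)).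
  apply is_series_ext. intros n.
  rewrite (pascal_array_expand f p q n Hf), <- sum_n_Reals.
  replace (sum_n (fun k => Binomial.C n k * ((-1) ^ k * f (p + k)%nat q)) n
      * / INR (fact n) * x ^ n)%R
    with (/ INR (fact n) * x ^ n
      * sum_n (fun k => Binomial.C n k * ((-1) ^ k * f (p + k)%nat q)) n)%R by ring.
  rewrite <- sum_n_Rmult_l. apply sum_n_R_ext. intros k Hk. unfold Binomial.C.
  replace (- x)%R with (-1 * x)%R by ring. rewrite Rpow_mult_distr.
  replace (x ^ n)%R with (x ^ k * x ^ (n - k))%R.
  2: { rewrite <- pow_add. f_equal. lia. }
  field. repeat split; apply INR_fact_neq_0.
Qed.

(* [Pcal s N] with [m = N - s]. *)
Definition binom_fact_sum (N m : nat) (y : R) : R :=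
  sum_n (fun n => Binomial.C N n * (INR (fact (N + m - n)) * y ^ n))%R N.

(** Pascal's rule for the binomials; up to sign and powers of [y] it mirrors the splitting 1 = t +
    (1-t) of the integrals. *)
Lemma binom_fact_sum_S (N m : nat) (y : R) :
  binom_fact_sum (S N) m y = (y * binom_fact_sum N m y + binom_fact_sum N (S m) y)%R.
Proof.
  unfold binom_fact_sum. rewrite binomial_sum_S.
  rewrite <- sum_n_Rmult_l, <- sum_n_Rplus.
  apply sum_n_R_ext. intros n _.
  replace (N + S m - n)%nat with (S N + m - n)%nat by lia.
  replace (S N + m - S n)%nat with (N + m - n)%nat by lia.
  change (y ^ S n)%R with (y * y ^ n)%R. ring.
Qed.

(** Here [beta_coeff n m / n!] equals m! / (n+m+1)!, so the left side is m! times the tail of the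
    exponential series past degree m. The subtracted sum is m! times its head, as C(m,n) (m-n)! = m!
    / n!. *)
Lemma regf_beta_0 (m : nat) (x : R) :
  (x ^ (m + 1) * regf (fun n => beta_coeff n m) x
   = exp x * binom_fact_sum 0 m (- x) - binom_fact_sum m 0 x)%R.
Proof.
  rewrite <- (regf_1 x). unfold regf, binom_fact_sum.
  rewrite (Series_incr_n (fun n => 1 * / INR (fact n) * x ^ n)%R (m + 1)%nat);
    [| lia | apply (ex_series_regf _ _ unit_bounded_1)].
  replace (Nat.pred (m + 1)) with m by lia.
  rewrite sum_O, C_n_0, <- sum_n_Reals.
  set (S1 := Series (fun k => 1 * / INR (fact (m + 1 + k)) * x ^ (m + 1 + k))%R).
  replace (sum_n (fun n => Binomial.C m n * (INR (fact (m + 0 - n)) * x ^ n))%R m)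
    with (INR (fact m) * sum_n (fun k => 1 * / INR (fact k) * x ^ k) m)%R.
  - replace (x ^ (m + 1) * Series (fun n => beta_coeff n m * / INR (fact n) * x ^ n))%R
      with (INR (fact m) * S1)%R.
    + replace (0 + m - 0)%nat with m by lia. simpl. ring.
    + unfold S1. rewrite <- !Series_scal_l. apply Series_ext. intros n.
      unfold beta_coeff. rewrite pow_add.
      replace (n + m + 1)%nat with (m + 1 + n)%nat by lia.
      field. split; apply INR_fact_neq_0.
  - rewrite <- sum_n_Rmult_l. apply sum_n_R_ext. intros n Hn. unfold Binomial.C.
    replace (m + 0 - n)%nat with (m - n)%nat by lia.
    field. split; apply INR_fact_neq_0.
Qed.

(** Induction on [N] for all [m]: the integral at [S N], [m] is the difference of those at [N], [m]
    and [N], [S m], and [binom_fact_sum_S] at [- x] and at [x] recombines the two right sides. *)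
Lemma regf_beta (N m : nat) (x : R) :
  (x ^ (N + m + 1) * regf (fun n => beta_coeff (N + n) m) x
   = (-1) ^ N * (exp x * binom_fact_sum N m (- x) - binom_fact_sum m N x))%R.
Proof.
  revert m. induction N as [| N IH]; intros m.
  - rewrite pow_O, Rmult_1_l. apply regf_beta_0.
  - pose proof (regf_pascal_array _ x beta_coeff_pascal beta_coeff_le_1 N m) as H.
    cbv beta in H.
    replace (regf (fun n => beta_coeff (S N + n) m) x) with
      (regf (fun n => beta_coeff (N + n) m) x
        - regf (fun n => beta_coeff (N + n) (S m)) x)%R by lra.
    rewrite Rmult_minus_distr_l.
    replace (x ^ (S N + m + 1))%R with (x * x ^ (N + m + 1))%R by reflexivity.
    rewrite Rmult_assoc, IH.
    replace (x * x ^ (N + m + 1))%R with (x ^ (N + S m + 1))%R.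
    2: { replace (N + S m + 1)%nat with (S (N + m + 1)) by lia. reflexivity. }
    rewrite IH, (binom_fact_sum_S N m), (binom_fact_sum_S m N). simpl. ring.
Qed.
(** * The kernel of [Fcal] as a power series *)

(** The fundamental theorem of calculus on each coordinate; the second derivative [k] supplies the
    continuity of the integrand. *)
Lemma is_RInt_segment (f g k : C -> C) (z : C) :
  (forall w, qdiff f w (g w)) -> (forall w, qdiff g w (k w)) ->
  is_RInt (V := C_R_NormedModule) (fun u : R => z * g (u * z)) 0 1 (f z - f 0).
Proof.
  intros Hf Hg.
  assert (Hz : forall h : C -> R, (h = Re \/ h = Im) ->
    is_RInt (fun u : R => h (z * g (u * z))) 0 1 (h (f z) - h (f (RtoC 0)))%R).
  { intros h Hh.
    assert (Hdf : forall u : R,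
      is_derive (fun t : R => h (f (t * z))) u (h (z * g (u * z)))).
    { intros u. destruct Hh as [-> | ->]; now apply qdiff_line. }
    assert (Hdg : forall u : R, continuous (fun t : R => h (z * g (t * z))) u).
    { intros u. apply (ex_derive_continuous (V := R_NormedModule)).
      exists (h (z * (z * k (u * z)))).
      destruct Hh as [-> | ->];
        apply (qdiff_line (fun w => z * g w)), qdiff_scal, Hg. }
    pose proof (is_RInt_derive (V := R_CompleteNormedModule)
      (fun t : R => h (f (t * z))) (fun t : R => h (z * g (t * z))) 0 1
      (fun u _ => Hdf u) (fun u _ => Hdg u)) as H.
    cbv beta in H. rewrite Cmult_1_l, Cmult_0_l in H. exact H. }
  rewrite (surjective_pairing (f z - f 0)).
  apply (is_RInt_fct_extend_pair (U := R_NormedModule) (V := R_NormedModule)).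
  - apply (Hz Re). now left.
  - apply (Hz Im). now right.
Qed.

Lemma is_RInt_C_comb (f g : R -> C) (If Ig : C) (a b c d : R) :
  is_RInt (V := C_R_NormedModule) f a b If ->
  is_RInt (V := C_R_NormedModule) g a b Ig ->
  is_RInt (V := C_R_NormedModule) (fun u => c * f u + d * g u) a b (c * If + d * Ig).
Proof.
  intros Hf Hg.
  assert (Hs : forall (k : R) (w : C), scal (V := C_R_NormedModule) k w = k * w).
  { intros k w. apply injective_projections.
    - change (k * fst w = k * fst w - 0 * snd w)%R. ring.
    - change (k * snd w = k * snd w + 0 * fst w)%R. ring. }
  rewrite <- !Hs. eapply is_RInt_ext.
  2: { apply (is_RInt_plus (V := C_R_NormedModule)); apply is_RInt_scal; eassumption. }
  intros u _. simpl. now rewrite <- !Hs.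
Qed.

Lemma RtoC_m1 : RtoC (-1) = - (1).
Proof. apply injective_projections; simpl; ring. Qed.

Lemma CSeries_incr_1_plus (a : nat -> C) :
  summable a -> CSeries a = a O + CSeries (fun n => a (S n)).
Proof.
  intros Ha. unfold CSeries. apply injective_projections; simpl.
  - apply (Series_incr_1 (fun n => Re (a n))). now apply summable_Re.
  - apply (Series_incr_1 (fun n => Im (a n))). now apply summable_Im.
Qed.

Lemma Rinv_INR_le_1 n : (0 <= / INR n <= 1)%R.
Proof.
  destruct n as [| n].
  - rewrite INR_0, Rinv_0. lra.
  - pose proof (Rinv_INR_S_bounds n). lra.
Qed.

(* [- int_0^z (exp t - 1) / t dt]; the term [n = 0] vanishes since [/ 0 = 0]. *)
Definition neg_Ein (z : C) : C := egf (fun n => - / INR n)%R z.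
Definition neg_Ein' (z : C) : C := egf (fun n => - / INR (S n))%R z.

Lemma unit_bounded_neg_Ein : unit_bounded (fun n => - / INR n)%R.
Proof.
  intros n. pose proof (Rinv_INR_le_1 n). rewrite Rabs_left1; lra.
Qed.

Lemma neg_Ein_qdiff (z : C) : qdiff neg_Ein z (neg_Ein' z).
Proof. exact (egf_qdiff _ z unit_bounded_neg_Ein). Qed.

Lemma neg_Ein'_eq (z : C) : z * neg_Ein' z = 1 - Cexp z.
Proof.
  unfold neg_Ein'.
  (* Weights 0, -1, -1, ...: the exponential series without its constant term, negated. *)
  rewrite <- (egf_mult_var _ (fun n => match n with O => 0 | S _ => -1 end)%R).
  - rewrite Cexp_egf. unfold egf.
    rewrite (CSeries_incr_1_plus _ (egf_summable _ z unit_bounded_1)).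
    rewrite CSeries_incr_1 by (rewrite Rmult_0_l; ring).
    replace (CSeries (fun n => (-1 * / INR (fact (S n)))%R * z ^ S n))
      with (- (1) * CSeries (fun n => (1 * / INR (fact (S n)))%R * z ^ S n)).
    + simpl fact. rewrite INR_1, Rinv_1, Rmult_1_r. simpl Cpow. ring.
    + rewrite <- CSeries_scal.
      * apply CSeries_ext. intros n. rewrite !RtoC_mult, RtoC_m1. ring.
      * apply (ex_series_incr_1 (fun n => Cmod ((1 * / INR (fact n))%R * z ^ n))).
        exact (egf_summable _ z unit_bounded_1).
  - intros n. exact (unit_bounded_neg_Ein (S n)).
  - reflexivity.
  - intros n. field. apply not_0_INR. discriminate.
Qed.

Lemma neg_Ein_0 : neg_Ein 0 = 0.
Proof. unfold neg_Ein. rewrite egf_0, INR_0, Rinv_0, Ropp_0. reflexivity. Qed.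

Lemma neg_Ein_integral (z : C) :
  is_RInt (V := C_R_NormedModule) (fun u : R => z * neg_Ein' (u * z)) 0 1 (neg_Ein z).
Proof.
  replace (neg_Ein z) with (neg_Ein z - neg_Ein 0) by (rewrite neg_Ein_0; ring).
  apply (is_RInt_segment _ _ (egf (fun n => - / INR (S (S n)))%R)).
  - apply neg_Ein_qdiff.
  - intros w. apply (egf_qdiff (fun n => - / INR (S n))%R).
    intros n. exact (unit_bounded_neg_Ein (S n)).
Qed.

(** Both integrands, of [Shi] and of [Chi], have this form, with [d = -1/2] and [d = 1/2]. The sign
    of [d] flips because the path to [- z] contributes a factor [- z]. *)
Lemma CInt0_neg_Ein_comb (f : C -> C) (d : R) (z : C) :
  z <> 0 ->
  (forall w : C, w <> 0 -> f w = (-1/2)%R * neg_Ein' w + d * neg_Ein' (- w)) ->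
  CInt0 f z = (-1/2)%R * neg_Ein z - d * neg_Ein (- z).
Proof.
  intros Hz Hf. unfold CInt0. apply (is_RInt_unique (V := C_R_CompleteNormedModule)).
  replace ((-1/2)%R * neg_Ein z - d * neg_Ein (- z))
    with ((-1/2)%R * neg_Ein z + (- d)%R * neg_Ein (- z)) by (rewrite RtoC_opp; ring).
  eapply is_RInt_ext.
  2: { apply is_RInt_C_comb; apply neg_Ein_integral. }
  (* Agreement is required only on the open interval, which avoids the conventional value at
     [u = 0]. *)
  intros u. rewrite Rmin_left, Rmax_right by lra. intros Hu. cbv beta.
  rewrite Hf.
  - replace (u * - z) with (- (u * z)) by ring. rewrite RtoC_opp.
    match goal with |- ?a = ?b => change (@eq C a b) end. ring.
  - apply Cmult_neq_0; [| exact Hz]. intros H. apply RtoC_inj in H. lra.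
Qed.

Lemma neg_Ein'_div (w : C) : w <> 0 -> neg_Ein' w = (1 - Cexp w) / w.
Proof. intros Hw. rewrite <- neg_Ein'_eq. now field. Qed.

Lemma Copp_neq_0 (w : C) : w <> 0 -> - w <> 0.
Proof. intros Hw H. apply Hw. replace w with (- - w) by ring. rewrite H. ring. Qed.

Lemma Shi_Chi_integrals (z : C) : z <> 0 ->
  CInt0 (fun t => Csinh t / t) z + CInt0 (fun t => (Ccosh t - 1) / t) z = - neg_Ein z.
Proof.
  intros Hz.
  assert (H2 : RtoC 2 <> 0) by (intros H; apply RtoC_inj in H; lra).
  rewrite (CInt0_neg_Ein_comb _ (-1/2)%R z Hz), (CInt0_neg_Ein_comb _ (1/2)%R z Hz).
  { rewrite !RtoC_div, RtoC_m1 by lra. field. }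
  all: intros w Hw; rewrite !neg_Ein'_div by auto using Copp_neq_0;
    unfold Csinh, Ccosh; rewrite !RtoC_div, RtoC_m1 by lra; field; auto using Copp_neq_0.
Qed.

Lemma unit_bounded_log_coeff (j : nat) : unit_bounded (fun n => log_coeff (n + j) 0).
Proof. intros n. apply log_coeff_le_1. Qed.

(** The logarithm and [euler_gamma] cancel, leaving [neg_Ein z / z]. Division by [z] turns the
    weights -1/n into -1/(n+1)^2, the moments of ln t. *)
Lemma Fcal_kernel_egf (z : C) : z <> 0 ->
  Fcal_kernel z = egf (fun n => log_coeff (n + 0) 0) z.
Proof.
  intros Hz. unfold Fcal_kernel, Chi, Shi.
  transitivity (neg_Ein z / z).
  - f_equal. apply Shi_Chi_integrals in Hz. replace (neg_Ein z) with (- - neg_Ein z) by ring. rewrite <- Hz. ring.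
  - unfold neg_Ein. rewrite (egf_mult_var (fun n => log_coeff (n + 0) 0)).
    + now field.
    + apply unit_bounded_log_coeff.
    + now rewrite INR_0, Rinv_0, Ropp_0.
    + intros n. rewrite log_coeff_0_r, Nat.add_0_r. field.
      apply not_0_INR. discriminate.
Qed.

(** A radius of at most [Cmod z / 2] keeps [z + h] away from 0, where [Fcal_kernel] has only a
    conventional value. *)
Lemma qdiff_ext_nonzero (f g : C -> C) (z d : C) :
  z <> 0 -> (forall w : C, w <> 0 -> f w = g w) -> qdiff f z d -> qdiff g z d.
Proof.
  intros Hz Hfg (K & delta & Hdelta & Hf).
  apply Cmod_gt_0 in Hz as Hz'.
  exists K, (Rmin delta (Cmod z / 2)). split; [apply Rmin_pos; lra |].
  intros h Hh. pose proof (Rmin_l delta (Cmod z / 2)). pose proof (Rmin_r delta (Cmod z / 2)).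
  rewrite <- (Hfg z Hz), <- Hfg.
  - apply Hf. lra.
  - intros H1. assert (H2 : z = - h).
    { rewrite <- (Cplus_0_l (- h)), <- H1. ring. }
    rewrite H2, Cmod_opp in *. lra.
Qed.

Lemma C_derive_n_Fcal_kernel (j : nat) (z : C) : z <> 0 ->
  C_derive_n Fcal_kernel j z = egf (fun n => log_coeff (n + j) 0) z.
Proof.
  revert z. induction j as [| j IH]; intros z Hz; [now apply Fcal_kernel_egf |].
  change (C_derive (C_derive_n Fcal_kernel j) z = egf (fun n => log_coeff (n + S j) 0) z).
  apply is_C_derive_unique, qdiff_is_derive.
  apply (qdiff_ext_nonzero (egf (fun n => log_coeff (n + j) 0)) _ z _ Hz).
  - intros w Hw. symmetry. now apply IH.
  - replace (egf (fun n => log_coeff (n + S j) 0) z)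
      with (egf (fun n => log_coeff (S n + j) 0) z).
    + apply (egf_qdiff (fun n => log_coeff (n + j) 0)), unit_bounded_log_coeff.
    + apply CSeries_ext. intros n. now rewrite Nat.add_succ_r.
Qed.
(** * The derivative of the Whittaker function *)

Lemma RtoC_sum_n (a : nat -> R) (n : nat) :
  sum_n (G := C_AbelianMonoid) (fun k => RtoC (a k)) n = RtoC (sum_n a n).
Proof.
  induction n as [| n IH]; [now rewrite !sum_O |].
  rewrite !sum_Sn, IH. symmetry. apply RtoC_plus.
Qed.

Lemma Pcal_binom_fact_sum (s : Z) (N m : nat) (y : R) :
  (2 * Z.of_nat N - s = Z.of_nat (N + m))%Z ->
  Pcal s (Z.of_nat N) y = binom_fact_sum N m y.
Proof.
  intros Hs. unfold Pcal, binom_fact_sum. rewrite Nat2Z.id.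
  rewrite <- RtoC_sum_n. apply (sum_n_ext_loc (G := C_AbelianMonoid)). intros n Hn.
  rewrite Hs, <- Nat2Z.inj_sub, Nat2Z.id by lia.
  rewrite !RtoC_mult, RtoC_pow. symmetry. apply Cmult_assoc.
Qed.

(** Expanding (1-t)^k down to exponent 0 leaves integrals of e^(yt) t^(p+n) ln t, which are the
    derivatives of order [p + n] of the kernel. *)
Lemma Fcal_regf (s : Z) (k p : nat) (y : R) :
  (Z.of_nat k - s = Z.of_nat p)%Z -> y <> 0%R ->
  Fcal s (Z.of_nat k) y = regf (fun n => log_coeff (p + n) k) y.
Proof.
  intros Hs Hy.
  pose proof (pascal_array_expand _ p 0 k
    (regf_pascal_array _ y log_coeff_pascal log_coeff_le_1)) as H.
  cbv beta in H. rewrite Nat.add_0_l in H. rewrite H. clear H.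
  unfold Fcal. rewrite Nat2Z.id, <- RtoC_sum_n.
  apply (sum_n_ext_loc (G := C_AbelianMonoid)). intros n Hn.
  replace (Z.of_nat n + Z.of_nat k - s)%Z with (Z.of_nat (p + n)) by lia.
  rewrite Nat2Z.id, C_derive_n_Fcal_kernel.
  - rewrite egf_RtoC, !RtoC_mult, RtoC_pow, RtoC_m1.
    rewrite (regf_ext _ (fun i => log_coeff (p + n + i) 0)).
    + match goal with |- ?a = ?b => change (@eq C a b) end. ring.
    + intros i. f_equal. lia.
  - intros H. now apply RtoC_inj in H.
Qed.

(** * Differentiation of 1F1 with respect to its parameters *)

Lemma Cinv_0 : / RtoC 0 = 0.
Proof. apply injective_projections; simpl; unfold Rdiv; ring. Qed.

(** The convention [/ 0 = 0] makes this unconditional, so the Pochhammer ratio factors for all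
    parameters. *)
Lemma Cinv_mult_distr (z w : C) : / (z * w) = / z * / w.
Proof.
  destruct (Req_dec (Cmod z) 0) as [Hz | Hz].
  { apply Cmod_eq_0 in Hz. subst z. rewrite Cmult_0_l, Cinv_0. ring. }
  destruct (Req_dec (Cmod w) 0) as [Hw | Hw].
  { apply Cmod_eq_0 in Hw. subst w. rewrite Cmult_0_r, Cinv_0. ring. }
  field. split; intros H; subst; now rewrite Cmod_0 in *.
Qed.

Lemma Cpochhammer_ratio (a c : C) (n : nat) :
  Cpochhammer a n / Cpochhammer c n = cprod (fun k => (a + INR k) / (c + INR k)) n.
Proof.
  induction n as [| n IH]; simpl.
  - field.
  - rewrite <- IH. unfold Cdiv. rewrite Cinv_mult_distr. ring.
Qed.

(** A displacement [h] of [mu] moves the parameters of 1F1 by [h] and [2 * h]. The remainder is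
    exactly -2 h^2 (s-2r) / (s^2 (s+2h)), where |s-2r| <= s^2 and |s+2h| >= 1; the constant 2 is
    thus uniform in the index of the factor. *)
Lemma mobius_remainder (r s : R) (h : C) :
  (2 <= s)%R -> (0 <= r <= s)%R -> (Cmod h <= 1 / 2)%R ->
  (Cmod ((r + h) / (s + 2 * h) - r / s - h * ((s - 2 * r) / s ^ 2)%R)%C <= 2 * Cmod h ^ 2)%R.
Proof.
  intros Hs Hr Hh.
  assert (Hs0 : RtoC s <> 0) by (intros H; apply RtoC_inj in H; lra).
  assert (Hd : (1 <= Cmod (s + 2 * h)%C)%R).
  { assert (H : (Cmod s <= Cmod (s + 2 * h)%C + Cmod (- (2 * h))%C)%R).
    { replace (RtoC s) with (s + 2 * h + - (2 * h)) at 1 by ring. apply Cmod_triangle. }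
    rewrite Cmod_opp, Cmod_mult, !Cmod_R, !Rabs_pos_eq in H by lra. lra. }
  assert (Hd0 : s + 2 * h <> 0) by (intros H; rewrite H, Cmod_0 in Hd; lra).
  replace ((r + h) / (s + 2 * h) - r / s - h * ((s - 2 * r) / s ^ 2)%R)
    with (RtoC (-2 * ((s - 2 * r) / s ^ 2)) * h ^ 2 / (s + 2 * h)).
  - rewrite Cmod_div, Cmod_mult, Cmod_R, Cmod_pow by exact Hd0.
    assert (H : (Rabs (-2 * ((s - 2 * r) / s ^ 2)) <= 2)%R).
    { assert (H1 : (-1 <= (s - 2 * r) / s ^ 2 <= 1)%R).
      { split; [apply Rle_div_r | apply Rle_div_l]; nra. }
      apply Rabs_le. lra. }
    pose proof (Cmod_ge_0 h).
    apply Rle_div_l; [lra |].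
    assert (H2 : (0 <= Cmod h ^ 2)%R) by nra. nra.
  - rewrite RtoC_mult, RtoC_div, RtoC_minus, RtoC_mult, RtoC_pow
      by (apply pow_nonzero; lra).
    replace (RtoC (-2)) with (- RtoC 2) by (rewrite <- RtoC_opp; reflexivity).
    field. now split.
Qed.

Section Hypergeometric.

Variables N m : nat.

(* [K = (N+m+1)! / (N! m!)] *)
Let K := (/ beta_coeff N m)%R.
(** The logarithmic derivative of Gamma(c) / (Gamma(a) Gamma(c-a)), equal to [K] at a = N+1, c =
    N+m+2, when a and c move at rates 1 and 2; Euler's constants cancel. *)
Let T := (2 * harmonic (N + m + 1) - harmonic N - harmonic m)%R.
Let s n := (INR N + INR m + 2 + INR n)%R.
Let r n := (INR N + 1 + INR n)%R.

Lemma cprod_beta_coeff n :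
  cprod (fun k => RtoC (r k) / RtoC (s k)) n = (K * beta_coeff (N + n) m)%R.
Proof.
  pose proof (beta_coeff_pos N m).
  induction n as [| n IH]; simpl.
  - rewrite Nat.add_0_r. f_equal. unfold K. field. lra.
  - assert (Hs : (s n <> 0)%R).
    { unfold s. pose proof (pos_INR N). pose proof (pos_INR m). pose proof (pos_INR n). lra. }
    rewrite IH, Nat.add_succ_r, beta_coeff_Sl, plus_INR.
    rewrite <- RtoC_div, <- RtoC_mult by exact Hs. f_equal. unfold r, s in *. field.
    intros H1. apply Hs. lra.
Qed.

(** Each factor has logarithmic derivative 1/r - 2/s, so harmonic numbers accumulate; [T] makes the
    value 0 at [n = 0]. *)
Lemma cprod_deriv_log_coeff n :
  cprod_deriv (fun k => RtoC (r k) / RtoC (s k))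
    (fun k => RtoC ((s k - 2 * r k) / s k ^ 2)) n
  = (K * (log_coeff (N + n) m + log_coeff m (N + n) + T * beta_coeff (N + n) m))%R.
Proof.
  assert (Hl : forall p q, (log_coeff p q + log_coeff q p
    = beta_coeff p q * (harmonic p + harmonic q - 2 * harmonic (p + q + 1)))%R).
  { intros p q. unfold log_coeff, beta_coeff.
    replace (q + p + 1)%nat with (p + q + 1)%nat by lia. field. apply INR_fact_neq_0. }
  induction n as [| n IH]; cbn [cprod_deriv].
  - rewrite Nat.add_0_r, Hl. f_equal. unfold T. ring.
  - assert (Hs : (s n <> 0)%R).
    { unfold s. pose proof (pos_INR N). pose proof (pos_INR m). pose proof (pos_INR n). lra. }
    rewrite IH, cprod_beta_coeff, !Hl, (Nat.add_succ_r N n), beta_coeff_Sl.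
    rewrite <- RtoC_div, <- !RtoC_mult, <- RtoC_plus by exact Hs. f_equal.
    replace (S (N + n) + m + 1)%nat with (S (N + n + m + 1)) by lia.
    rewrite !harmonic_S, !S_INR, !plus_INR. simpl (INR 1).
    unfold r, s in *. pose proof (pos_INR N). pose proof (pos_INR m). pose proof (pos_INR n).
    field. repeat split; lra.
Qed.

Lemma hyp1F1_qdiff (x : R) :
  hyp1F1 (INR N + 1) (INR N + INR m + 2) x
    = (K * regf (fun n => beta_coeff (N + n) m) x)%R /\
  qdiff (fun h => hyp1F1 (INR N + 1 + h) (INR N + INR m + 2 + 2 * h) x) 0
    (K * (regf (fun n => log_coeff (N + n) m) x + regf (fun n => log_coeff m (N + n)) x
       + T * regf (fun n => beta_coeff (N + n) m) x))%R.
Proof.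
  set (u := fun n (h : C) => (RtoC (r n) + h) / (RtoC (s n) + 2 * h)).
  assert (Hhyp : forall h, CSeries (fun n => x ^ n / INR (fact n) * cprod (fun k => u k h) n)
    = hyp1F1 (INR N + 1 + h) (INR N + INR m + 2 + 2 * h) x).
  { intros h. apply CSeries_ext. intros n. rewrite Cpochhammer_ratio, Cmult_comm.
    f_equal. clear. induction n as [| n IH]; [reflexivity |]. simpl. rewrite IH. f_equal.
    unfold u, r, s. rewrite !RtoC_plus. f_equal; ring. }
  assert (Hbounds : forall n, (2 <= s n)%R /\ (0 <= r n <= s n)%R).
  { intros n. unfold r, s. pose proof (pos_INR N). pose proof (pos_INR m).
    pose proof (pos_INR n). lra. }
  assert (Hu0 : forall n, u n 0 = r n / s n).
  { intros n. unfold u. now rewrite Cmult_0_r, !Cplus_0_r. }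
  assert (Hterm : forall n a, x ^ n / INR (fact n) * RtoC (K * a)
    = RtoC (K * (a * / INR (fact n) * x ^ n))%R).
  { intros n a. rewrite !RtoC_mult, RtoC_pow, RtoC_inv by apply INR_fact_neq_0.
    unfold Cdiv. ring. }
  assert (Hcprod0 : forall n, cprod (fun k => u k 0) n = (K * beta_coeff (N + n) m)%R).
  { intros n. rewrite <- cprod_beta_coeff. now apply cprod_ext. }
  split.
  - replace (hyp1F1 (INR N + 1) (INR N + INR m + 2) x) with
      (hyp1F1 (INR N + 1 + 0) (INR N + INR m + 2 + 2 * 0) x).
    2: { rewrite Cmult_0_r. now rewrite !Cplus_0_r. }
    rewrite <- Hhyp. unfold regf. rewrite <- Series_scal_l, <- CSeries_RtoC.
    apply CSeries_ext. intros n. now rewrite Hcprod0, Hterm.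
  - assert (H1 : forall n, (Cmod (u n 0) <= 1)%R).
    { intros n. destruct (Hbounds n) as [Hs Hr].
      rewrite Hu0, <- RtoC_div, Cmod_R by lra. apply Rabs_le.
      split; [apply Rle_div_r | apply Rle_div_l]; lra. }
    assert (H2 : forall n, (Cmod ((s n - 2 * r n) / s n ^ 2)%R <= 1)%R).
    { intros n. destruct (Hbounds n) as [Hs Hr]. rewrite Cmod_R. apply Rabs_le.
      split; [apply Rle_div_r | apply Rle_div_l]; nra. }
    assert (H3 : forall n h, (Cmod h <= 1 / 2)%R ->
      (Cmod (u n (0 + h) - u n 0 - h * ((s n - 2 * r n) / s n ^ 2)%R)%C <= 2 * Cmod h ^ 2)%R).
    { intros n h Hh. destruct (Hbounds n) as [Hs Hr].
      rewrite Hu0, Cplus_0_l. now apply mobius_remainder. }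
    (* Factors and their derivatives are bounded by 1 at [h = 0]; the constant 2 and the radius 1/2
       come from [mobius_remainder]. *)
    pose proof (cprod_series_qdiff u _ 0 1 1 2 (1 / 2) ltac:(lra) H1 H2 ltac:(lra) H3
      (fun n => x ^ n / INR (fact n)) (Rabs x) ltac:(lra)) as H.
    assert (H4 : forall n, (Cmod (x ^ n / INR (fact n))%C <= / INR (fact n) * Rabs x ^ n)%R).
    { intros n. rewrite Cmod_div, Cmod_pow, !Cmod_R, (Rabs_pos_eq (INR _)).
      - right. unfold Rdiv. ring.
      - apply pos_INR.
      - intros E. apply RtoC_inj in E. now apply INR_fact_neq_0 in E. }
    specialize (H H4). cbv beta in H.
    eapply qdiff_ext in H; [| exact Hhyp].
    match goal with |- qdiff _ _ ?d => match type of H with qdiff _ _ ?e =>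
      replace d with e; [exact H |] end end.
    assert (Hex : forall a : nat -> R, (forall n, (Rabs (a n) <= 1)%R) ->
      ex_series (fun n => a n * / INR (fact n) * x ^ n)%R).
    { intros a Ha. now apply ex_series_regf. }
    rewrite <- regf_scal, <- !regf_plus, <- regf_scal.
    + unfold regf. rewrite <- CSeries_RtoC.
      apply CSeries_ext. intros n.
      rewrite (cprod_deriv_ext _ _ _ n Hu0), cprod_deriv_log_coeff, Hterm.
      f_equal. ring.
    + apply (ex_series_ext (fun n => log_coeff (N + n) m * / INR (fact n) * x ^ n
        + log_coeff m (N + n) * / INR (fact n) * x ^ n)%R).
      { intros n. simpl. ring. }
      apply (ex_series_plus (V := R_NormedModule)); apply Hex; intros; apply log_coeff_le_1.
    + apply (ex_series_ext (fun n => T * (beta_coeff (N + n) m * / INR (fact n) * x ^ n))%R).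
      { intros n. simpl. ring. }
      apply (ex_series_scal_l (K := R_AbsRing) (V := R_NormedModule)), Hex.
      intros; apply beta_coeff_le_1.
    + apply Hex. intros; apply log_coeff_le_1.
    + apply Hex. intros; apply log_coeff_le_1.
Qed.

End Hypergeometric.

(** * Complex powers of a real base, and the Whittaker function *)

Lemma Cexp_pow (z : C) (n : nat) : Cexp (INR n * z) = Cexp z ^ n.
Proof.
  induction n as [| n IH].
  - simpl. rewrite Cmult_0_l. apply Cexp_0.
  - rewrite S_INR, RtoC_plus, Cmult_plus_distr_r, Cmult_1_l, Cexp_plus, IH, Cpow_S. ring.
Qed.

Lemma Cexp_Cln (x : R) : x <> 0%R -> Cexp (Cln x) = x.
Proof.
  intros Hx. unfold Cln, Carg. rewrite Cmod_R. simpl.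
  destruct (Rlt_dec 0 0) as [H | _]; [lra |].
  unfold Cexp. simpl. rewrite exp_ln by now apply Rabs_pos_lt.
  destruct (Rdichotomy x 0 Hx) as [H | H].
  - rewrite Rabs_left by exact H.
    (* For negative [x] the argument is acos(-1) = PI, and e^(i PI) = -1 restores the sign. *)
    replace (x / - x)%R with (- (1))%R by (field; lra).
    rewrite acos_opp, acos_1, Rminus_0_r, cos_PI, sin_PI.
    apply injective_projections; simpl; ring.
  - rewrite Rabs_right by lra.
    replace (x / x)%R with 1%R by (field; lra).
    rewrite acos_1, cos_0, sin_0.
    apply injective_projections; simpl; ring.
Qed.

(** Splits off an ordinary real power also for negative [x]; with [n = N + M + 1] it reduces the
    exponent [mu + 1 / 2] to l/2 - m. *)
Lemma Cpower_plus_INR (x : R) (w : C) (n : nat) : x <> 0%R ->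
  Cpower x (w + INR n) = Cpower x w * RtoC (x ^ n).
Proof.
  intros Hx. unfold Cpower.
  rewrite Cmult_plus_distr_r, Cexp_plus, Cexp_pow, Cexp_Cln, RtoC_pow by exact Hx.
  reflexivity.
Qed.

Lemma WhittakerM_qdiff (kappa mu x d : C) :
  qdiff (fun h => hyp1F1 (1 / 2 + mu - kappa + h) (1 + 2 * mu + 2 * h) x) 0 d ->
  qdiff (fun w => WhittakerM kappa w x) mu
    (Cpower x (mu + 1 / 2) * Cexp (- x / 2)
     * (Cln x * hyp1F1 (1 / 2 + mu - kappa) (1 + 2 * mu) x + d)).
Proof.
  intros Hd.
  assert (H2 : RtoC 2 <> 0) by (intros E; apply RtoC_inj in E; lra).
  assert (Hp : qdiff (fun w => Cexp (- x / 2) * Cpower x (w + 1 / 2)) mu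
    (Cexp (- x / 2) * (Cln x * Cpower x (mu + 1 / 2)))).
  { apply qdiff_scal.
    apply (qdiff_ext (fun w => Cexp (Cln x * w + Cln x / 2))).
    - intros w. unfold Cpower. f_equal. now field.
    - apply qdiff_comp_affine.
      replace ((mu + 1 / 2) * Cln x) with (Cln x * mu + Cln x / 2) by now field.
      unfold Cpower.
      replace ((mu + 1 / 2) * Cln x) with (Cln x * mu + Cln x / 2) by now field.
      apply Cexp_qdiff. }
  assert (Hh : qdiff (fun w => hyp1F1 (1 / 2 + w - kappa) (1 + 2 * w) x) mu d).
  (* Change of variable from [w] to the displacement [w - mu], written in the affine form
     [1 * w + - mu]. *)
  { rewrite <- (Cmult_1_l d).
    apply (qdiff_ext (fun w => hyp1F1 (1 / 2 + mu - kappa + (1 * w + - mu))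
      (1 + 2 * mu + 2 * (1 * w + - mu)) x)).
    - intros w. f_equal; ring.
    - apply (qdiff_comp_affine (fun h => hyp1F1 (1 / 2 + mu - kappa + h)
        (1 + 2 * mu + 2 * h) x)).
      now replace (1 * mu + - mu) with (RtoC 0) by ring. }
  pose proof (qdiff_mult _ _ _ _ _ Hp Hh) as H.
  replace (Cpower x (mu + 1 / 2) * Cexp (- x / 2)
    * (Cln x * hyp1F1 (1 / 2 + mu - kappa) (1 + 2 * mu) x + d))
    with (Cexp (- x / 2) * (Cln x * Cpower x (mu + 1 / 2))
      * hyp1F1 (1 / 2 + mu - kappa) (1 + 2 * mu) x
      + Cexp (- x / 2) * Cpower x (mu + 1 / 2) * d) by ring.
  revert H. apply qdiff_ext. intros w. unfold WhittakerM. ring.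
Qed.

Theorem theorem24 (l m : Z) (x : R)
  (Hm : (0 <= m)%Z) (Hlm : (l <= m)%Z) (Hx : x <> 0%R) :
  is_derive (K := C_AbsRing) (V := C_NormedModule)
    (fun mu : C => WhittakerM (IZR l / 2) mu x)
    (IZR m + (1 - IZR l) / 2)
    (IZR (2 * m - l + 1) * Binomial.C (Z.to_nat (2 * m - l)) (Z.to_nat m)
     * Cpower x (IZR l / 2 - IZR m) * exp (- x / 2)
     * (powerRZ (-1) (m - l)
        * (Cln x + 2 * harmonic (Z.to_nat (2 * m - l + 1))
           - harmonic (Z.to_nat (m - l)) - harmonic (Z.to_nat m))
        * (exp x * Pcal (- l) (m - l) (- x) - Pcal l m x)
        + powerRZ x (2 * m + 1 - l)
          * (exp x * Fcal (- l) (m - l) (- x) + Fcal l m x))).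
Proof.
  destruct (Z_of_nat_complete m Hm) as [M HM].
  destruct (Z_of_nat_complete (m - l)) as [N HN]; [lia |].
  assert (Hl : l = (Z.of_nat M - Z.of_nat N)%Z) by lia. subst m l.
  set (l := (Z.of_nat M - Z.of_nat N)%Z) in *.
  assert (H2 : RtoC 2 <> 0) by (intros E; apply RtoC_inj in E; lra).
  apply qdiff_is_derive.
  assert (Hl : RtoC (IZR l) = INR M - INR N).
  { unfold l. now rewrite minus_IZR, <- !INR_IZR_INZ, RtoC_minus. }
  destruct (hyp1F1_qdiff N M x) as [Hhyp Hqd].
  set (mu := IZR (Z.of_nat M) + (1 - IZR l) / 2).
  assert (Ha : 1 / 2 + mu - IZR l / 2 = INR N + 1).
  { unfold mu. rewrite Hl, <- INR_IZR_INZ. now field. }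
  assert (Hc : 1 + 2 * mu = INR N + INR M + 2).
  { unfold mu. rewrite Hl, <- INR_IZR_INZ. now field. }
  assert (Hp : mu + 1 / 2 = IZR l / 2 - IZR (Z.of_nat M) + INR (N + M + 1)).
  { unfold mu. rewrite Hl, <- INR_IZR_INZ, !plus_INR, !RtoC_plus. simpl (INR 1). now field. }
  rewrite <- Ha, <- Hc in Hqd. apply WhittakerM_qdiff in Hqd.
  match type of Hqd with qdiff _ _ ?e => match goal with |- qdiff _ _ ?d =>
    replace d with e; [exact Hqd |] end end.
  rewrite Ha, Hc, Hhyp, Hp, Cpower_plus_INR by exact Hx.
  replace (- x / 2) with (RtoC (- x / 2)) by (rewrite RtoC_div, RtoC_opp by lra; reflexivity).
  rewrite Cexp_RtoC, HN.
  replace (2 * Z.of_nat M - l + 1)%Z with (Z.of_nat (N + M + 1)) by lia.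
  replace (2 * Z.of_nat M + 1 - l)%Z with (Z.of_nat (N + M + 1)) by lia.
  replace (2 * Z.of_nat M - l)%Z with (Z.of_nat (N + M)) by lia.
  rewrite !Nat2Z.id, <- !pow_powerRZ, <- (INR_IZR_INZ (N + M + 1)), <- RtoC_opp.
  rewrite (Pcal_binom_fact_sum _ N M), (Pcal_binom_fact_sum _ M N) by lia.
  rewrite (Fcal_regf _ N M), (Fcal_regf _ M N) by (lia || lra).
  (* The binomial prefactor of the theorem is the constant of Euler's integral. *)
  assert (HK : (INR (N + M + 1) * Binomial.C (N + M) M = / beta_coeff N M)%R).
  { unfold beta_coeff, Binomial.C. replace (N + M - M)%nat with N by lia.
    replace (N + M + 1)%nat with (S (N + M)) by lia. rewrite fact_simpl, mult_INR.
    field. repeat split; try apply INR_fact_neq_0. apply not_0_INR. discriminate. }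
  rewrite <- !RtoC_mult, HK.
  pose proof (regf_beta N M x) as HI.
  (* Turns the ln(1-t) integral at [x] into the ln t integral at [- x], as [Fcal] requires. *)
  pose proof (regf_kummer log_coeff M N x log_coeff_pascal log_coeff_le_1) as HJ.
  rewrite HJ.
  set (I := regf (fun n => beta_coeff (N + n) M) x) in *.
  set (J := regf (fun n => log_coeff (N + n) M) x) in *.
  set (J' := regf (fun n => log_coeff (M + n) N) (- x)) in *.
  set (A := binom_fact_sum N M (- x)) in *. set (B := binom_fact_sum M N x) in *.
  assert (HI' : RtoC (x ^ (N + M + 1)) * I = RtoC ((-1) ^ N) * (exp x * A - B)).
  { rewrite <- RtoC_mult, HI. now rewrite RtoC_mult, RtoC_minus, RtoC_mult. }
  repeat (rewrite RtoC_mult || rewrite RtoC_plus || rewrite RtoC_minus).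
  set (X := RtoC (x ^ (N + M + 1))) in *. set (P := Cpower _ _).
  set (K := RtoC (/ beta_coeff N M)).
  (* The logarithmic and harmonic terms multiply [X * I], which [HI'] converts to the [Pcal]
     bracket; the log integrals keep the factor [X]. *)
  transitivity (K * P * exp (- x / 2) *
    ((Cln x + 2%R * harmonic (N + M + 1) - harmonic N - harmonic M) * (X * I) + X * (exp x * J' + J))).
  - ring.
  - rewrite HI'. ring.
Qed.
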